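(* Let $X$ be a separable Hilbert space and let $f(z)=\sum_{k\ge1}a_kz^{n_k}\in H^2(\mathbb{D},X)$ be a lacunary series (so $n_{k+1}/n_k\ge d>1$ for all $k$) such that the sequence $(a_k)_{k\ge1}$ is completely relatively compact in $X$. Let $X_*=X_*(f)$ and let $P_{X_*}f=\sum_k (P_{X_*}a_k)z^{n_k}$, where $P_{X_*}$ is the orthogonal projection of $X$ onto $X_*$. Then $p:=f-P_{X_*}f$ is a polynomial and $$E_f=H^2(\mathbb{D},X_* )\oplus E_p$$ (orthogonal direct sum), where $H^2(\mathbb{D},X_* )$ is the subspace of $H^2(\mathbb{D},X)$ of functions with all Taylor coefficients in $X_*$.
   Context: $H^2(\mathbb{D},X)$ is the space of $X$-valued power series $f=\sum_{n\ge0}\hat f(n)z^n$ with $\sum\|\hat f(n)\|^2<\infty$; $S^*\sum_n\hat f(n)z^n=\sum_n\hat f(n+1)z^n$ is the backward shift. For $g\in H^2(\mathbb{D},X)$, $E_g$ is the closed linear span of $\{S^{*n}g:n\ge0\}$. A lacunary series is $f=\sum_k a_kz^{n_k}$ with $(n_k)$ increasing nonnegative integers with $n_{k+1}/n_k\ge d>1$ for all $k$ ($d$ independent of $k$). $X_*(f)=\bigcap_{n\ge0}\operatorname{span}_X\{\hat f(k):k\ge n\}$ (closed spans). A sequence $(a_k)$ in a Hilbert space $X$ is completely relatively compact (c.r.c.) if for every orthogonal projection $P:X\to X$, with $\eta=\{k:Pa_k\neq0\}$, the sequence $(Pa_k/\|Pa_k\|)_{k\in\eta}$ is relatively compact in $X$.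 *)

(* Defs.v *)
From Stdlib Require Import Reals.
Open Scope R_scope.

Record Cx := mkC { Re : R; Im : R }.
Definition C0 : Cx := mkC 0 0.
Definition C1 : Cx := mkC 1 0.
Definition Cadd (a b : Cx) : Cx := mkC (Re a + Re b) (Im a + Im b).
Definition Cmul (a b : Cx) : Cx :=
  mkC (Re a * Re b - Im a * Im b) (Re a * Im b + Im a * Re b).
Definition Cconj (a : Cx) : Cx := mkC (Re a) (- Im a).
Definition RtoC (r : R) : Cx := mkC r 0.

Record Hilbert := {
  hcar :> Type;
  hzero : hcar;
  hadd : hcar -> hcar -> hcar;
  hopp : hcar -> hcar;
  hscal : Cx -> hcar -> hcar;
  hinner : hcar -> hcar -> Cx;
  hadd_assoc : forall x y z, hadd x (hadd y z) = hadd (hadd x y) z;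
  hadd_comm : forall x y, hadd x y = hadd y x;
  hadd_0l : forall x, hadd hzero x = x;
  hadd_oppl : forall x, hadd (hopp x) x = hzero;
  hscal_assoc : forall a b x, hscal a (hscal b x) = hscal (Cmul a b) x;
  hscal_1 : forall x, hscal C1 x = x;
  hscal_addr : forall a x y, hscal a (hadd x y) = hadd (hscal a x) (hscal a y);
  hscal_addl : forall a b x, hscal (Cadd a b) x = hadd (hscal a x) (hscal b x);
  hinner_addl : forall x y z, hinner (hadd x y) z = Cadd (hinner x z) (hinner y z);
  hinner_scall : forall a x y, hinner (hscal a x) y = Cmul a (hinner x y);
  hinner_conj : forall x y, hinner y x = Cconj (hinner x y);
  hinner_pos : forall x, 0 <= Re (hinner x x);
  hinner_def : forall x, hinner x x = C0 -> x = hzero;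
  hcomplete : forall u : nat -> hcar,
    (forall eps, 0 < eps -> exists N, forall m k, (N <= m)%nat -> (N <= k)%nat ->
        sqrt (Re (hinner (hadd (u m) (hopp (u k))) (hadd (u m) (hopp (u k))))) < eps) ->
    exists l, forall eps, 0 < eps -> exists N, forall m, (N <= m)%nat ->
        sqrt (Re (hinner (hadd (u m) (hopp l)) (hadd (u m) (hopp l)))) < eps
}.

Arguments hzero {h}.
Arguments hadd {h}.
Arguments hopp {h}.
Arguments hscal {h}.
Arguments hinner {h}.

Section Defs.
Context {X : Hilbert}.

Definition hsub (x y : X) : X := hadd x (hopp y).
Definition hnorm (x : X) : R := sqrt (Re (hinner x x)).

Definition separable : Prop :=
  exists e : nat -> X, forall x eps, 0 < eps -> exists k, hnorm (hsub x (e k)) < eps.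

Fixpoint vsum (g : nat -> X) (N : nat) : X :=
  match N with O => hzero | S N' => hadd (vsum g N') (g N') end.

Definition in_cspan (b : nat -> X) (x : X) : Prop :=
  forall eps, 0 < eps -> exists (N : nat) (c : nat -> Cx),
    hnorm (hsub x (vsum (fun k => hscal (c k) (b k)) N)) < eps.

(** X_*(f) = \bigcap_n closed span { fhat k : k >= n }, f given by its Taylor coefficients *)
Definition Xstar (f : nat -> X) (x : X) : Prop :=
  forall n, in_cspan (fun k => f (n + k)%nat) x.

Definition is_orth_proj (P : X -> X) : Prop :=
  (forall x, P (P x) = P x) /\ (forall x y, hinner (P x) y = hinner x (P y)).

Definition is_orth_proj_onto (M : X -> Prop) (P : X -> X) : Prop :=
  forall x, M (P x) /\ (forall m, M m -> hinner (hsub x (P x)) m = C0).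

Definition rel_compact (Sx : X -> Prop) : Prop :=
  forall u : nat -> X, (forall j, Sx (u j)) ->
    exists phi : nat -> nat, (forall j, (phi j < phi (S j))%nat) /\
      exists l, forall eps, 0 < eps -> exists N, forall j, (N <= j)%nat ->
        hnorm (hsub (u (phi j)) l) < eps.

Definition crc (a : nat -> X) : Prop :=
  forall P, is_orth_proj P ->
    rel_compact (fun x => exists k, P (a k) <> hzero /\
                   x = hscal (RtoC (/ hnorm (P (a k)))) (P (a k))).

(** H^2(D,X): X-valued power series (coefficient sequences) with sum ||f n||^2 < oo *)
Definition inH2 (f : nat -> X) : Prop :=
  exists M, forall K, sum_f_R0 (fun m => Rsqr (hnorm (f m))) K <= M.

Definition inH2_sub (M : X -> Prop) (f : nat -> X) : Prop :=
  inH2 f /\ forall m, M (f m).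

(** E_g: closed linear span in H^2 of { S*^j g : j >= 0 }, (S*^j g) m = g (m+j) *)
Definition in_E (g : nat -> X) (h : nat -> X) : Prop :=
  inH2 h /\ forall eps, 0 < eps -> exists (N : nat) (c : nat -> Cx),
    forall K, sum_f_R0 (fun m =>
       Rsqr (hnorm (hsub (h m) (vsum (fun j => hscal (c j) (g (m + j)%nat)) N)))) K <= eps.

Definition h2_inner_is (u v : nat -> X) (z : Cx) : Prop :=
  infinite_sum (fun m => Re (hinner (u m) (v m))) (Re z) /\
  infinite_sum (fun m => Im (hinner (u m) (v m))) (Im z).

End Defs.

(* Main.v *)
(* Everything is tested by duality: a vector lies in a closed span iff it is orthogonal to
   all vectors orthogonal to the generators, both in X and in the Hilbert space H^2(D, X).

   The p-part: if (I - P_{X_*}) a_k were nonzero infinitely often, a limit point of the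
   normalized vectors would be a unit vector that lies in X_* and is orthogonal to X_*.

   The inclusion H^2(D, X_* ) in E_f: let g be orthogonal to all S*^j f and put w = P_{X_*} g,
   b_k = Q a_k with Q the projection onto the closed span of the w(l). For large k,
   orthogonality reads <b_k, w(l)> = - sum_{j>k} <b_j, w(l + n_j - n_k)>, so that
   |<b_k, w(l)>|^2 <= t_{k+1} gamma_k, where t_k = sum_{j>=k} |b_j|^2 and
   gamma_k = sum_{j>k} |w(l + n_j - n_k)|^2. Lacunarity bounds the number of representations
   of an integer as n_j - n_k, hence sum_k gamma_k < oo. Complete relative compactness
   bounds |b_k| by finitely many |<b_k, w(l)>|, whence t_k <= (1 + C gamma_k) t_{k+1}; as
   t_k -> 0 and the product of the factors converges, t_k = 0 for large k. Thus w(l), which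
   lies in X_*, is orthogonal to all late a_k, and w = 0. *)
From Coquelicot Require Import Rbar Hierarchy Lim_seq Series.
From Stdlib Require Import Reals Lra Lia Classical IndefiniteDescription.
From Stdlib Require Import FunctionalExtensionality ProofIrrelevance.
Require Import Defs.
Open Scope bool_scope.
Open Scope R_scope.

(** * Inner products and orthogonal projections *)

(** Splitting the complex inner product into real and imaginary parts, and working with squared
    norms, turns most goals into statements about reals within reach of [ring], [lra] and [nra]. *)
Definition rin {X : Hilbert} (x y : X) : R := Re (hinner x y).
Definition iin {X : Hilbert} (x y : X) : R := Im (hinner x y).
Definition nrm2 {X : Hilbert} (x : X) : R := rin x x.

Lemma Cx_ext (a b : Cx) : Re a = Re b -> Im a = Im b -> a = b.
Proof. destruct a, b; simpl; congruence. Qed.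

Lemma inner_eq0 {X : Hilbert} (x y : X) :
  hinner x y = C0 <-> rin x y = 0 /\ iin x y = 0.
Proof.
  unfold rin, iin; split.
  - intros ->; split; reflexivity.
  - intros [H1 H2]; apply Cx_ext; assumption.
Qed.

Lemma rin_sym {X : Hilbert} (x y : X) : rin x y = rin y x.
Proof. unfold rin; rewrite (hinner_conj _ y x); reflexivity. Qed.

Lemma iin_sym {X : Hilbert} (x y : X) : iin x y = - iin y x.
Proof. unfold iin; rewrite (hinner_conj _ y x); reflexivity. Qed.

Lemma rin_addl {X : Hilbert} (x y z : X) : rin (hadd x y) z = rin x z + rin y z.
Proof. unfold rin; rewrite hinner_addl; reflexivity. Qed.

Lemma iin_addl {X : Hilbert} (x y z : X) : iin (hadd x y) z = iin x z + iin y z.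
Proof. unfold iin; rewrite hinner_addl; reflexivity. Qed.

Lemma rin_addr {X : Hilbert} (x y z : X) : rin z (hadd x y) = rin z x + rin z y.
Proof. rewrite rin_sym, rin_addl, (rin_sym x), (rin_sym y); reflexivity. Qed.

Lemma iin_addr {X : Hilbert} (x y z : X) : iin z (hadd x y) = iin z x + iin z y.
Proof. rewrite iin_sym, iin_addl, (iin_sym x), (iin_sym y); ring. Qed.

Lemma rin_scall {X : Hilbert} c (x z : X) :
  rin (hscal c x) z = Re c * rin x z - Im c * iin x z.
Proof. unfold rin, iin; rewrite hinner_scall; reflexivity. Qed.

Lemma iin_scall {X : Hilbert} c (x z : X) :
  iin (hscal c x) z = Re c * iin x z + Im c * rin x z.
Proof. unfold rin, iin; rewrite hinner_scall; reflexivity. Qed.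

Lemma rin_scalr {X : Hilbert} c (x z : X) :
  rin z (hscal c x) = Re c * rin z x + Im c * iin z x.
Proof. rewrite rin_sym, rin_scall, (rin_sym x), (iin_sym x); ring. Qed.

Lemma iin_scalr {X : Hilbert} c (x z : X) :
  iin z (hscal c x) = Re c * iin z x - Im c * rin z x.
Proof. rewrite iin_sym, iin_scall, (rin_sym x), (iin_sym x); ring. Qed.

Lemma rin_0l {X : Hilbert} (z : X) : rin hzero z = 0.
Proof.
  pose proof (rin_addl hzero hzero z) as H; rewrite hadd_0l in H; lra.
Qed.

Lemma iin_0l {X : Hilbert} (z : X) : iin hzero z = 0.
Proof.
  pose proof (iin_addl hzero hzero z) as H; rewrite hadd_0l in H; lra.
Qed.

Lemma rin_0r {X : Hilbert} (z : X) : rin z hzero = 0.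
Proof. rewrite rin_sym; apply rin_0l. Qed.

Lemma iin_0r {X : Hilbert} (z : X) : iin z hzero = 0.
Proof. rewrite iin_sym, iin_0l; ring. Qed.

Lemma rin_oppl {X : Hilbert} (x z : X) : rin (hopp x) z = - rin x z.
Proof.
  pose proof (rin_addl (hopp x) x z) as H; rewrite hadd_oppl, rin_0l in H; lra.
Qed.

Lemma iin_oppl {X : Hilbert} (x z : X) : iin (hopp x) z = - iin x z.
Proof.
  pose proof (iin_addl (hopp x) x z) as H; rewrite hadd_oppl, iin_0l in H; lra.
Qed.

Lemma rin_oppr {X : Hilbert} (x z : X) : rin z (hopp x) = - rin z x.
Proof. rewrite rin_sym, rin_oppl, (rin_sym x); ring. Qed.

Lemma iin_oppr {X : Hilbert} (x z : X) : iin z (hopp x) = - iin z x.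
Proof. rewrite iin_sym, iin_oppl, (iin_sym x); ring. Qed.

Lemma rin_subl {X : Hilbert} (x y z : X) : rin (hsub x y) z = rin x z - rin y z.
Proof. unfold hsub; rewrite rin_addl, rin_oppl; ring. Qed.

Lemma iin_subl {X : Hilbert} (x y z : X) : iin (hsub x y) z = iin x z - iin y z.
Proof. unfold hsub; rewrite iin_addl, iin_oppl; ring. Qed.

Lemma rin_subr {X : Hilbert} (x y z : X) : rin z (hsub x y) = rin z x - rin z y.
Proof. unfold hsub; rewrite rin_addr, rin_oppr; ring. Qed.

Lemma iin_subr {X : Hilbert} (x y z : X) : iin z (hsub x y) = iin z x - iin z y.
Proof. unfold hsub; rewrite iin_addr, iin_oppr; ring. Qed.

#[local] Hint Rewrite @rin_addl @rin_addr @iin_addl @iin_addr @rin_oppl @rin_oppr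
  @iin_oppl @iin_oppr @rin_subl @rin_subr @iin_subl @iin_subr @rin_scall @rin_scalr
  @iin_scall @iin_scalr @rin_0l @rin_0r @iin_0l @iin_0r : inner.

Ltac expand_inner := unfold nrm2; autorewrite with inner; simpl Re; simpl Im.

Lemma nrm2_ge0 {X : Hilbert} (x : X) : 0 <= nrm2 x.
Proof. apply hinner_pos. Qed.

Lemma iin_diag {X : Hilbert} (x : X) : iin x x = 0.
Proof. pose proof (iin_sym x x); lra. Qed.

Lemma nrm2_eq0 {X : Hilbert} (x : X) : nrm2 x = 0 -> x = hzero.
Proof. intros H; apply hinner_def, inner_eq0; split; [exact H | apply iin_diag]. Qed.

Lemma nrm2_0 {X : Hilbert} : nrm2 (hzero : X) = 0.
Proof. apply rin_0l. Qed.

Lemma nrm2_opp {X : Hilbert} (x : X) : nrm2 (hopp x) = nrm2 x.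
Proof. expand_inner; ring. Qed.

Lemma nrm2_sub_comm {X : Hilbert} (x y : X) : nrm2 (hsub x y) = nrm2 (hsub y x).
Proof. expand_inner; ring. Qed.

Lemma hsub_eq0 {X : Hilbert} (x y : X) : hsub x y = hzero -> x = y.
Proof.
  intros H. rewrite <- (hadd_0l _ y), <- H. unfold hsub.
  rewrite <- hadd_assoc, hadd_oppl, hadd_comm, hadd_0l; reflexivity.
Qed.

(** Real inner products separate points, since [hsub x y] may serve as test vector. This is what
    lets the tactic [vec] prove vector identities by [ring]. *)
Lemma rin_ext {X : Hilbert} (x y : X) : (forall z, rin x z = rin y z) -> x = y.
Proof.
  intros H; apply hsub_eq0, nrm2_eq0; unfold nrm2.
  rewrite rin_subl, H; ring.
Qed.

Ltac vec := apply rin_ext; intro; expand_inner; ring.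

Lemma hsub_0r {X : Hilbert} (x : X) : hsub x hzero = x.
Proof. vec. Qed.

(** Cauchy-Schwarz: subtracting from [x] its real projection onto the line of [y] leaves a vector of
    nonnegative squared norm. *)
Lemma rin_sqr_le {X : Hilbert} (x y : X) : Rsqr (rin x y) <= nrm2 x * nrm2 y.
Proof.
  pose proof (nrm2_ge0 y) as Hy.
  destruct (Req_dec (nrm2 y) 0) as [H0 | H0].
  - rewrite (nrm2_eq0 y H0), rin_0r, nrm2_0; unfold Rsqr; lra.
  - pose proof (nrm2_ge0 (hsub x (hscal (RtoC (rin x y / nrm2 y)) y))) as H.
    assert (E : nrm2 (hsub x (hscal (RtoC (rin x y / nrm2 y)) y))
                = nrm2 x - Rsqr (rin x y) / nrm2 y).
    { unfold Rsqr; unfold nrm2 at 1; unfold RtoC; expand_inner.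
      rewrite (rin_sym y x); fold (nrm2 x) (nrm2 y); field.
      exact H0. }
    rewrite E in H.
    assert (0 < nrm2 y) by lra.
    apply Rmult_le_reg_r with (/ nrm2 y); [apply Rinv_0_lt_compat; lra |].
    replace (nrm2 x * nrm2 y * / nrm2 y) with (nrm2 x) by (field; lra).
    unfold Rdiv in H; lra.
Qed.

(** Multiplying the second argument by the imaginary unit reduces facts about imaginary parts to
    facts about real parts. *)
Lemma iin_as_rin {X : Hilbert} (x y : X) : iin x y = rin x (hscal (mkC 0 1) y).
Proof. expand_inner; ring. Qed.

Lemma nrm2_scal {X : Hilbert} c (x : X) :
  nrm2 (hscal c x) = (Rsqr (Re c) + Rsqr (Im c)) * nrm2 x.
Proof. unfold Rsqr; expand_inner; rewrite iin_diag; ring. Qed.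

Lemma iin_sqr_le {X : Hilbert} (x y : X) : Rsqr (iin x y) <= nrm2 x * nrm2 y.
Proof.
  rewrite iin_as_rin.
  eapply Rle_trans; [apply rin_sqr_le |].
  rewrite nrm2_scal; simpl; unfold Rsqr; lra.
Qed.

Lemma Rabs_le_half_add (r a b : R) :
  Rsqr r <= a * b -> 0 <= a -> 0 <= b -> Rabs r <= (a + b) / 2.
Proof.
  intros H Ha Hb; apply Rsqr_incr_0_var; [| lra].
  pose proof (Rle_0_sqr (a - b)) as Hs.
  rewrite <- Rsqr_abs; unfold Rsqr in *; lra.
Qed.

Lemma rin_abs_le {X : Hilbert} (x y : X) : Rabs (rin x y) <= (nrm2 x + nrm2 y) / 2.
Proof. apply Rabs_le_half_add; [apply rin_sqr_le | apply nrm2_ge0 ..]. Qed.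

Lemma iin_abs_le {X : Hilbert} (x y : X) : Rabs (iin x y) <= (nrm2 x + nrm2 y) / 2.
Proof. apply Rabs_le_half_add; [apply iin_sqr_le | apply nrm2_ge0 ..]. Qed.

Lemma nrm2_add_le {X : Hilbert} (x y : X) : nrm2 (hadd x y) <= 2 * nrm2 x + 2 * nrm2 y.
Proof.
  pose proof (nrm2_ge0 (hsub x y)) as H; revert H; expand_inner.
  rewrite (rin_sym y x); lra.
Qed.

Lemma hnorm_sqr {X : Hilbert} (x : X) : Rsqr (hnorm x) = nrm2 x.
Proof. apply Rsqr_sqrt, nrm2_ge0. Qed.

Lemma hnorm_ge0 {X : Hilbert} (x : X) : 0 <= hnorm x.
Proof. apply sqrt_pos. Qed.

Lemma hnorm_lt {X : Hilbert} (x : X) eps : 0 < eps -> hnorm x < eps <-> nrm2 x < Rsqr eps.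
Proof.
  intros He; rewrite <- hnorm_sqr; split; intros H.
  - apply Rsqr_incrst_1; [exact H | apply hnorm_ge0 | lra].
  - apply Rsqr_incrst_0; [exact H | apply hnorm_ge0 | lra].
Qed.

Definition conv {X : Hilbert} (u : nat -> X) (l : X) : Prop :=
  is_lim_seq (fun j => nrm2 (hsub (u j) l)) 0.

Lemma conv_iff {X : Hilbert} (u : nat -> X) (l : X) :
  conv u l <-> forall eps, 0 < eps -> exists N, forall j, (N <= j)%nat ->
        hnorm (hsub (u j) l) < eps.
Proof.
  unfold conv; rewrite <- is_lim_seq_spec; simpl; split; [intros H eps He | intros H eps].
  - assert (H2 : 0 < Rsqr eps) by (apply Rlt_0_sqr; lra).
    destruct (H (mkposreal _ H2)) as [N HN]; exists N; intros j Hj.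
    apply hnorm_lt; [exact He |].
    specialize (HN j Hj); simpl in HN.
    rewrite Rminus_0_r in HN; eapply Rle_lt_trans; [apply Rle_abs | exact HN].
  - destruct eps as [eps Hp]; simpl.
    destruct (H (sqrt eps)) as [N HN]; [apply sqrt_lt_R0; exact Hp |].
    exists N; intros j Hj; rewrite Rminus_0_r, Rabs_pos_eq by apply nrm2_ge0.
    specialize (HN j Hj); apply hnorm_lt in HN; [| apply sqrt_lt_R0; exact Hp].
    rewrite Rsqr_sqrt in HN by lra; exact HN.
Qed.

Lemma conv_rin {X : Hilbert} (u : nat -> X) l z :
  conv u l -> is_lim_seq (fun j => rin (u j) z) (rin l z).
Proof.
  intros H.
  assert (K : is_lim_seq (fun j => sqrt (nrm2 (hsub (u j) l)) * sqrt (nrm2 z)) 0).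
  { replace (Finite 0) with (Rbar_mult (sqrt 0) (sqrt (nrm2 z)))
      by (simpl; rewrite sqrt_0; f_equal; ring).
    apply is_lim_seq_mult'; [| apply is_lim_seq_const].
    apply (is_lim_seq_continuous sqrt); [apply continuity_pt_sqrt; lra | exact H]. }
  assert (L : is_lim_seq (fun j => rin (hsub (u j) l) z) 0).
  { apply is_lim_seq_abs_0.
    refine (is_lim_seq_le_le (fun _ => 0) _ _ 0 _ (is_lim_seq_const 0) K).
    intros j; split; [apply Rabs_pos |].
    rewrite <- sqrt_mult by apply nrm2_ge0.
    rewrite <- sqrt_Rsqr_abs; apply sqrt_le_1_alt, rin_sqr_le. }
  apply is_lim_seq_ext with (fun j => rin (hsub (u j) l) z + rin l z).
  { intros j; rewrite rin_subl; ring. }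
  replace (Finite (rin l z)) with (Rbar_plus 0 (rin l z)) by (simpl; f_equal; ring).
  apply is_lim_seq_plus'; [exact L | apply is_lim_seq_const].
Qed.

Lemma conv_iin {X : Hilbert} (u : nat -> X) l z :
  conv u l -> is_lim_seq (fun j => iin (u j) z) (iin l z).
Proof.
  intros H; rewrite iin_as_rin.
  apply is_lim_seq_ext with (fun j => rin (u j) (hscal (mkC 0 1) z)).
  - intros j; symmetry; apply iin_as_rin.
  - apply conv_rin, H.
Qed.

(** Expanding [nrm2 (hsub (u j) l)] reduces this to convergence of the inner products with [l]. *)
Lemma conv_nrm2 {X : Hilbert} (u : nat -> X) l :
  conv u l -> is_lim_seq (fun j => nrm2 (u j)) (nrm2 l).
Proof.
  intros H.
  apply is_lim_seq_ext with (fun j => nrm2 (hsub (u j) l) + (2 * rin (u j) l - nrm2 l)).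
  { intros j; expand_inner; rewrite (rin_sym l); ring. }
  replace (Finite (nrm2 l)) with (Finite (0 + (2 * rin l l - nrm2 l)))
    by (f_equal; unfold nrm2; ring).
  apply is_lim_seq_plus'; [exact H |].
  apply is_lim_seq_minus'; [| apply is_lim_seq_const].
  apply is_lim_seq_mult'; [apply is_lim_seq_const | apply conv_rin, H].
Qed.

Lemma conv_sub_l {X : Hilbert} (u : nat -> X) l x :
  conv u l -> conv (fun j => hsub x (u j)) (hsub x l).
Proof.
  apply is_lim_seq_ext; intros j; expand_inner; ring.
Qed.

Lemma hilbert_complete {X : Hilbert} (u : nat -> X) :
  (forall eps, 0 < eps -> exists N, forall m k, (N <= m)%nat -> (N <= k)%nat ->
     nrm2 (hsub (u m) (u k)) < eps) -> exists l, conv u l.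
Proof.
  intros H; destruct (hcomplete X u) as [l Hl].
  - intros eps He; destruct (H (Rsqr eps)) as [N HN]; [apply Rlt_0_sqr; lra |].
    exists N; intros m k Hm Hk; apply (hnorm_lt (hsub (u m) (u k)) eps He).
    apply HN; assumption.
  - exists l; apply conv_iff, Hl.
Qed.

(** * Orthogonality and the projection theorem *)

Definition orth {X : Hilbert} (x y : X) : Prop := rin x y = 0 /\ iin x y = 0.

Lemma orth_sym {X : Hilbert} (x y : X) : orth x y -> orth y x.
Proof. intros [H1 H2]; split; [rewrite rin_sym | rewrite iin_sym]; lra. Qed.

Definition is_subspace {X : Hilbert} (F : X -> Prop) : Prop :=
  F hzero /\ (forall x y, F x -> F y -> F (hadd x y)) /\ forall c x, F x -> F (hscal c x).

Lemma lim_inv_succ : is_lim_seq (fun j => / (INR j + 1)) 0.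
Proof.
  apply is_lim_seq_ext with (fun j => / INR (S j)).
  - intros j; rewrite S_INR; reflexivity.
  - apply (is_lim_seq_incr_1 (fun j => / INR j)).
    replace (Finite 0) with (Rbar_inv p_infty) by reflexivity.
    apply is_lim_seq_inv; [apply is_lim_seq_INR | discriminate].
Qed.

Lemma inv_succ_small eps : 0 < eps -> exists N, forall j, (N <= j)%nat -> / (INR j + 1) < eps.
Proof.
  intros He.
  destruct (proj2 (is_lim_seq_spec _ _) lim_inv_succ (mkposreal _ He)) as [N HN].
  exists N; intros j Hj; specialize (HN j Hj); simpl in HN.
  rewrite Rminus_0_r in HN; eapply Rle_lt_trans; [apply Rle_abs | exact HN].
Qed.

Lemma linear_term_zero (b c : R) :
  (forall t, 0 <= t * t * c - 2 * t * b) -> b = 0.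
Proof.
  intros H; destruct (Req_dec b 0) as [| Hb]; [assumption | exfalso].
  assert (Hc : 0 <= c) by (pose proof (H 1); pose proof (H (-1)); lra).
  (* Near the minimizer [b / c]; the denominator [c + 1] also covers [c = 0]. *)
  specialize (H (b / (c + 1))).
  replace (b / (c + 1) * (b / (c + 1)) * c - 2 * (b / (c + 1)) * b)
    with (- (Rsqr (b / (c + 1)) * (c + 2))) in H by (unfold Rsqr; field; lra).
  assert (0 < Rsqr (b / (c + 1))).
  { apply Rlt_0_sqr; unfold Rdiv; apply Rmult_integral_contrapositive_currified;
      [exact Hb | apply Rinv_neq_0_compat; lra]. }
  nra.
Qed.

Lemma inf_exists (E : R -> Prop) : (exists r, E r) -> (forall r, E r -> 0 <= r) ->
  exists m, (forall r, E r -> m <= r) /\ forall eps, 0 < eps -> exists r, E r /\ r < m + eps.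
Proof.
  intros [r0 Hr0] Hpos.
  destruct (completeness (fun r => E (- r))) as [m [Hub Hlub]].
  - exists 0; intros r Hr; specialize (Hpos _ Hr); lra.
  - exists (- r0); rewrite Ropp_involutive; exact Hr0.
  - exists (- m); split.
    + intros r Hr; specialize (Hub (- r)); cbv beta in Hub; rewrite Ropp_involutive in Hub.
      specialize (Hub Hr); lra.
    + intros eps He; apply NNPP; intros Hn.
      assert (m <= m - eps); [| lra].
      apply Hlub; intros r Hr; apply Rnot_lt_le; intros Hlt; apply Hn.
      exists (- r); split; [exact Hr | lra].
Qed.

(** Minimizing sequence argument. [F] need not be closed, so [y] is only a limit of elements of [F];
    this suits the set of finite linear combinations. *)
Lemma projection_exists {X : Hilbert} (F : X -> Prop) (x : X) : is_subspace F ->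
  exists y, (exists s, (forall j, F (s j)) /\ conv s y) /\ forall z, F z -> orth (hsub x y) z.
Proof.
  intros [F0 [Fadd Fscal]].
  destruct (inf_exists (fun r => exists z, F z /\ r = nrm2 (hsub x z))) as [m [Hm Hinf]].
  { exists (nrm2 (hsub x hzero)), hzero; auto. }
  { intros r [z [_ ->]]; apply nrm2_ge0. }
  assert (Hs : forall j, exists z, F z /\ nrm2 (hsub x z) < m + / (INR j + 1)).
  { intros j; destruct (Hinf (/ (INR j + 1))) as [r [[z [Hz ->]] Hr]].
    - apply Rinv_0_lt_compat; pose proof (pos_INR j); lra.
    - exists z; auto. }
  apply functional_choice in Hs as [s Hs].
  (* Parallelogram law: the midpoint of [s i] and [s k] lies in [F], hence at squared distance at
     least [m] from [x]. Each of the two excesses over [m] is counted twice, whence [eps / 4]. *)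
  assert (Hc : exists y, conv s y).
  { apply hilbert_complete; intros eps He.
    destruct (inv_succ_small (eps / 4)) as [N HN]; [lra |].
    exists N; intros i k Hi Hk.
    pose proof (HN _ Hi); pose proof (HN _ Hk).
    destruct (Hs i) as [Fi Hi']; destruct (Hs k) as [Fk Hk'].
    assert (Hmid : m <= nrm2 (hsub x (hscal (RtoC (/ 2)) (hadd (s i) (s k))))).
    { apply Hm; eexists; split; [| reflexivity]; auto. }
    assert (E : nrm2 (hsub (s i) (s k)) = 2 * nrm2 (hsub x (s i)) + 2 * nrm2 (hsub x (s k))
       - 4 * nrm2 (hsub x (hscal (RtoC (/ 2)) (hadd (s i) (s k))))).
    { unfold RtoC; expand_inner.
      rewrite (rin_sym (s i) x), (rin_sym (s k) x), (rin_sym (s k) (s i)).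
      field. }
    rewrite E; lra. }
  destruct Hc as [y Hy]; exists y; split.
  { exists s; split; [intros j; apply Hs | exact Hy]. }
  assert (Hle : nrm2 (hsub x y) <= m).
  { apply (is_lim_seq_le (fun j => nrm2 (hsub x (s j))) (fun j => m + / (INR j + 1))
       (nrm2 (hsub x y)) m).
    - intros j; apply Rlt_le, Hs.
    - apply conv_nrm2, conv_sub_l, Hy.
    - replace (Finite m) with (Finite (m + 0)) by (f_equal; ring).
      apply is_lim_seq_plus'; [apply is_lim_seq_const | apply lim_inv_succ]. }
  (* As [y] may lie outside [F], minimality is applied to [s j + z] and passed to the limit. *)
  assert (Hge : forall z, F z -> m <= nrm2 (hsub (hsub x y) z)).
  { intros z Hz.
    apply (is_lim_seq_le (fun _ => m) (fun j => nrm2 (hsub (hsub x z) (s j)))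
       m (nrm2 (hsub (hsub x y) z))).
    - intros j; apply Hm; exists (hadd (s j) z); split; [apply Fadd; [apply Hs | exact Hz] |].
      f_equal; vec.
    - apply is_lim_seq_const.
    - replace (hsub (hsub x y) z) with (hsub (hsub x z) y) by vec.
      apply conv_nrm2, conv_sub_l, Hy. }
  (* First variation of the squared distance along [z]; replacing [z] by its multiple by the
     imaginary unit then gives the imaginary part. *)
  assert (Hr : forall z, F z -> rin (hsub x y) z = 0).
  { intros z Hz; apply (linear_term_zero _ (nrm2 z)); intros t.
    specialize (Hge (hscal (RtoC t) z) (Fscal _ _ Hz)).
    assert (E : nrm2 (hsub (hsub x y) (hscal (RtoC t) z)) =
       nrm2 (hsub x y) + (t * t * nrm2 z - 2 * t * rin (hsub x y) z)).
    { set (v := hsub x y); unfold RtoC; expand_inner.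
      rewrite (rin_sym z v); ring. }
    rewrite E in Hge; lra. }
  intros z Hz; split; [apply Hr, Hz |].
  rewrite iin_as_rin; apply Hr, Fscal, Hz.
Qed.

(** * Finite linear combinations and closed spans *)

Definition lin_comb {X : Hilbert} (b : nat -> X) (x : X) : Prop :=
  exists N c, x = vsum (fun k => hscal (c k) (b k)) N.

Lemma vsum_ext {X : Hilbert} (u v : nat -> X) N :
  (forall k, (k < N)%nat -> u k = v k) -> vsum u N = vsum v N.
Proof.
  intros H; induction N as [| N IH]; simpl; [reflexivity |].
  rewrite IH, (H N); auto.
Qed.

(** Padding with zero coefficients brings two combinations to a common length before they are
    added. *)
Lemma vsum_truncate {X : Hilbert} (b : nat -> X) c N M : (N <= M)%nat ->
  vsum (fun k => hscal (if (k <? N)%nat then c k else C0) (b k)) M =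
  vsum (fun k => hscal (c k) (b k)) N.
Proof.
  intros H; induction H as [| M HM IH].
  - apply vsum_ext; intros k Hk; apply Nat.ltb_lt in Hk; rewrite Hk; reflexivity.
  - simpl; rewrite IH.
    replace (M <? N)%nat with false by (symmetry; apply Nat.ltb_ge; exact HM).
    unfold C0; vec.
Qed.

Lemma vsum_add {X : Hilbert} (u v : nat -> X) N :
  vsum (fun k => hadd (u k) (v k)) N = hadd (vsum u N) (vsum v N).
Proof. induction N as [| N IH]; simpl; [vec | rewrite IH; vec]. Qed.

Lemma vsum_scal {X : Hilbert} c (u : nat -> X) N :
  vsum (fun k => hscal c (u k)) N = hscal c (vsum u N).
Proof. induction N as [| N IH]; simpl; [vec | rewrite IH; vec]. Qed.

Lemma lin_comb_subspace {X : Hilbert} (b : nat -> X) : is_subspace (lin_comb b).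
Proof.
  split; [exists 0%nat, (fun _ => C0); reflexivity | split].
  - intros x y [N [c ->]] [M [e ->]].
    exists (Nat.max N M), (fun k => Cadd (if (k <? N)%nat then c k else C0)
                                         (if (k <? M)%nat then e k else C0)).
    rewrite <- (vsum_truncate b c N (Nat.max N M)), <- (vsum_truncate b e M (Nat.max N M)) by lia.
    rewrite <- vsum_add; apply vsum_ext; intros; rewrite hscal_addl; reflexivity.
  - intros e x [N [c ->]]; exists N, (fun k => Cmul e (c k)).
    rewrite <- vsum_scal; apply vsum_ext; intros; apply hscal_assoc.
Qed.

Lemma vsum_zero {X : Hilbert} (u : nat -> X) N :
  (forall k, (k < N)%nat -> u k = hzero) -> vsum u N = hzero.
Proof.
  intros H; induction N as [| N IH]; simpl; [reflexivity |].
  rewrite IH, (H N) by auto; apply hadd_0l.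
Qed.

Lemma lin_comb_gen {X : Hilbert} (b : nat -> X) k : lin_comb b (b k).
Proof.
  exists (S k), (fun j => if (j =? k)%nat then C1 else C0); simpl.
  rewrite Nat.eqb_refl, vsum_zero, hadd_0l, hscal_1; [reflexivity |].
  intros j Hj; replace (j =? k)%nat with false by (symmetry; apply Nat.eqb_neq; lia).
  unfold C0; vec.
Qed.

Lemma orth_addl {X : Hilbert} (x y z : X) : orth x z -> orth y z -> orth (hadd x y) z.
Proof. intros [A1 A2] [B1 B2]; split; expand_inner; lra. Qed.

Lemma orth_scall {X : Hilbert} c (x z : X) : orth x z -> orth (hscal c x) z.
Proof. intros [A1 A2]; split; expand_inner; rewrite A1, A2; ring. Qed.

Lemma orth_0l {X : Hilbert} (z : X) : orth hzero z.
Proof. split; [apply rin_0l | apply iin_0l]. Qed.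

Lemma orth_lin_comb {X : Hilbert} (b : nat -> X) x y :
  lin_comb b x -> (forall k, orth (b k) y) -> orth x y.
Proof.
  intros [N [c ->]] H; induction N as [| N IH]; simpl.
  - apply orth_0l.
  - apply orth_addl; [exact IH | apply orth_scall, H].
Qed.

Lemma conv_orth {X : Hilbert} (s : nat -> X) x y :
  conv s x -> (forall j, orth (s j) y) -> orth x y.
Proof.
  intros Hc H; split.
  - pose proof (is_lim_seq_unique _ _ (conv_rin s x y Hc)) as E.
    rewrite (Lim_seq_ext _ (fun _ => 0)), Lim_seq_const in E; [congruence | intros j; apply H].
  - pose proof (is_lim_seq_unique _ _ (conv_iin s x y Hc)) as E.
    rewrite (Lim_seq_ext _ (fun _ => 0)), Lim_seq_const in E; [congruence | intros j; apply H].
Qed.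

Lemma in_cspan_conv {X : Hilbert} (b : nat -> X) x :
  in_cspan b x <-> exists s, (forall j, lin_comb b (s j)) /\ conv s x.
Proof.
  split.
  - intros H.
    assert (Hs : forall j, exists z, lin_comb b z /\ nrm2 (hsub x z) < / (INR j + 1)).
    { intros j; assert (Hj : 0 < / (INR j + 1))
        by (apply Rinv_0_lt_compat; pose proof (pos_INR j); lra).
      destruct (H (sqrt (/ (INR j + 1)))) as [N [c Hc]]; [apply sqrt_lt_R0, Hj |].
      eexists; split; [exists N, c; reflexivity |].
      apply hnorm_lt in Hc; [| apply sqrt_lt_R0, Hj].
      rewrite Rsqr_sqrt in Hc by lra; exact Hc. }
    apply functional_choice in Hs as [s Hs]; exists s; split; [apply Hs |].
    refine (is_lim_seq_le_le (fun _ => 0) _ _ 0 _ (is_lim_seq_const 0) lim_inv_succ).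
    intros j; split; [apply nrm2_ge0 | rewrite nrm2_sub_comm; apply Rlt_le, Hs].
  - intros [s [Hs Hc]] eps He.
    destruct (proj1 (conv_iff _ _) Hc eps He) as [J HJ].
    destruct (Hs J) as [N [c E]]; exists N, c; rewrite <- E.
    apply hnorm_lt; [exact He |]; rewrite nrm2_sub_comm; apply hnorm_lt; [exact He |].
    apply HJ; lia.
Qed.

Lemma cspan_projection {X : Hilbert} (b : nat -> X) x :
  exists y, in_cspan b y /\ forall k, orth (hsub x y) (b k).
Proof.
  destruct (projection_exists (lin_comb b) x (lin_comb_subspace b)) as [y [Hy Ho]].
  exists y; split; [apply in_cspan_conv, Hy | intros k; apply Ho, lin_comb_gen].
Qed.

(** The duality test. For the converse, let [y] be the projection of [x]: the remainder [x - y] is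
    orthogonal to the generators, hence to [x] by hypothesis and to [y] by continuity, so it
    vanishes. *)
Lemma in_cspan_orth {X : Hilbert} (b : nat -> X) x :
  in_cspan b x <-> forall y, (forall k, orth (b k) y) -> orth x y.
Proof.
  split.
  - intros H y Hy; apply in_cspan_conv in H as [s [Hs Hc]].
    apply (conv_orth s); [exact Hc | intros j; apply (orth_lin_comb b); auto].
  - intros H; destruct (cspan_projection b x) as [y [Hy Ho]].
    assert (Ho' : forall k, orth (b k) (hsub x y)) by (intros k; apply orth_sym, Ho).
    assert (E : x = y); [| rewrite E; exact Hy].
    apply hsub_eq0, nrm2_eq0; unfold nrm2 at 1; rewrite rin_subl.
    rewrite (proj1 (H _ Ho')).
    apply in_cspan_conv in Hy as [s [Hs Hc]].
    rewrite (proj1 (conv_orth s y (hsub x y) Hc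
      (fun j => orth_lin_comb b (s j) (hsub x y) (Hs j) Ho'))); ring.
Qed.

(** * The Hilbert space H^2(D, X) *)

Lemma is_series_lim_sum (a : nat -> R) (l : R) :
  is_series a l <-> is_lim_seq (fun K => sum_f_R0 a K) l.
Proof. rewrite is_series_Reals, is_lim_seq_Reals; reflexivity. Qed.

Lemma sum_le_Series (a : nat -> R) K :
  (forall k, 0 <= a k) -> ex_series a -> sum_f_R0 a K <= Series a.
Proof.
  intros H0 [l Hl]; rewrite (is_series_unique _ _ Hl).
  apply (is_lim_seq_incr_compare (fun K => sum_f_R0 a K)).
  - apply is_series_lim_sum, Hl.
  - intros j; simpl; specialize (H0 (S j)); lra.
Qed.

Lemma series_of_bounded_sums (a : nat -> R) M : (forall k, 0 <= a k) ->
  (forall K, sum_f_R0 a K <= M) -> ex_series a /\ Series a <= M.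
Proof.
  intros H0 HM.
  destruct (ex_finite_lim_seq_incr (fun K => sum_f_R0 a K) M) as [l Hl].
  - intros j; simpl; specialize (H0 (S j)); lra.
  - exact HM.
  - pose proof (proj2 (is_series_lim_sum a l) Hl) as Hs; split; [exists l; exact Hs |].
    rewrite (is_series_unique _ _ Hs).
    exact (is_lim_seq_le _ _ l M HM Hl (is_lim_seq_const M)).
Qed.

Lemma ex_series_Rle (a b : nat -> R) :
  (forall k, Rabs (a k) <= b k) -> ex_series b -> ex_series a.
Proof. apply (@ex_series_le R_AbsRing R_CompleteNormedModule). Qed.

Lemma ex_series_add (a b : nat -> R) :
  ex_series a -> ex_series b -> ex_series (fun k => a k + b k).
Proof. apply (@ex_series_plus R_AbsRing R_NormedModule). Qed.

Lemma ex_series_mul (c : R) (a : nat -> R) : ex_series a -> ex_series (fun k => c * a k).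
Proof. apply (@ex_series_scal R_AbsRing R_NormedModule c a). Qed.

Lemma inH2_ex_series {X : Hilbert} (f : nat -> X) :
  inH2 f <-> ex_series (fun m => nrm2 (f m)).
Proof.
  split.
  - intros [M HM].
    apply (series_of_bounded_sums _ M); [intros; apply nrm2_ge0 |].
    intros K; erewrite sum_eq; [apply HM |]; intros; symmetry; apply hnorm_sqr.
  - intros H; exists (Series (fun m => nrm2 (f m))); intros K.
    erewrite sum_eq; [apply sum_le_Series; [intros; apply nrm2_ge0 | exact H] |].
    intros; apply hnorm_sqr.
Qed.

Lemma inH2_le {X : Hilbert} (c : R) (f g : nat -> X) :
  (forall m, nrm2 (g m) <= c * nrm2 (f m)) -> inH2 f -> inH2 g.
Proof.
  rewrite !inH2_ex_series; intros H Hf.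
  apply (ex_series_Rle _ (fun m => c * nrm2 (f m))).
  - intros k; rewrite Rabs_pos_eq by apply nrm2_ge0; apply H.
  - apply ex_series_mul, Hf.
Qed.

Lemma inH2_add {X : Hilbert} (f g : nat -> X) :
  inH2 f -> inH2 g -> inH2 (fun m => hadd (f m) (g m)).
Proof.
  rewrite !inH2_ex_series; intros Hf Hg.
  apply (ex_series_Rle _ (fun m => 2 * nrm2 (f m) + 2 * nrm2 (g m))).
  - intros k; rewrite Rabs_pos_eq by apply nrm2_ge0; apply nrm2_add_le.
  - apply ex_series_add; apply ex_series_mul; assumption.
Qed.

Lemma inH2_scal {X : Hilbert} c (f : nat -> X) :
  inH2 f -> inH2 (fun m => hscal c (f m)).
Proof.
  apply (inH2_le (Rsqr (Re c) + Rsqr (Im c))); intros m; rewrite nrm2_scal; lra.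
Qed.

Lemma inH2_opp {X : Hilbert} (f : nat -> X) : inH2 f -> inH2 (fun m => hopp (f m)).
Proof. apply (inH2_le 1); intros m; rewrite nrm2_opp; lra. Qed.

Lemma inH2_zero {X : Hilbert} : inH2 (fun _ => hzero : X).
Proof.
  apply inH2_ex_series; exists 0; apply is_series_lim_sum.
  apply is_lim_seq_ext with (fun _ => 0); [| apply is_lim_seq_const].
  intros K; symmetry; apply sum_eq_R0; intros; apply nrm2_0.
Qed.

Lemma inH2_shift {X : Hilbert} (f : nat -> X) j : inH2 f -> inH2 (fun m => f (m + j)%nat).
Proof.
  rewrite !inH2_ex_series; intros H.
  apply (ex_series_incr_n _ j) in H; revert H.
  apply ex_series_ext; intros k; rewrite Nat.add_comm; reflexivity.
Qed.

Lemma ex_series_rin {X : Hilbert} (f g : nat -> X) :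
  inH2 f -> inH2 g -> ex_series (fun m => rin (f m) (g m)).
Proof.
  rewrite !inH2_ex_series; intros Hf Hg.
  apply (ex_series_Rle _ (fun m => / 2 * nrm2 (f m) + / 2 * nrm2 (g m))).
  - intros k; eapply Rle_trans; [apply rin_abs_le |]; lra.
  - apply ex_series_add; apply ex_series_mul; assumption.
Qed.

Lemma ex_series_iin {X : Hilbert} (f g : nat -> X) :
  inH2 f -> inH2 g -> ex_series (fun m => iin (f m) (g m)).
Proof.
  rewrite !inH2_ex_series; intros Hf Hg.
  apply (ex_series_Rle _ (fun m => / 2 * nrm2 (f m) + / 2 * nrm2 (g m))).
  - intros k; eapply Rle_trans; [apply iin_abs_le |]; lra.
  - apply ex_series_add; apply ex_series_mul; assumption.
Qed.

(** Bundling sequences with their summability makes H^2 itself an instance of [Hilbert], so that the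
    projection theorem and the duality test apply to it unchanged. *)
Record l2 (X : Hilbert) := mkl2 { l2_fun :> nat -> X; l2_inH2 : inH2 l2_fun }.
Arguments mkl2 {X}.
Arguments l2_fun {X}.
Arguments l2_inH2 {X}.

Lemma l2_ext {X : Hilbert} (f g : l2 X) : (forall m, f m = g m) -> f = g.
Proof.
  destruct f as [f Hf], g as [g Hg]; simpl; intros H.
  apply functional_extensionality in H; subst g.
  f_equal; apply proof_irrelevance.
Qed.

Definition l2_add {X : Hilbert} (f g : l2 X) : l2 X :=
  mkl2 _ (inH2_add f g (l2_inH2 f) (l2_inH2 g)).
Definition l2_scal {X : Hilbert} c (f : l2 X) : l2 X := mkl2 _ (inH2_scal c f (l2_inH2 f)).
Definition l2_opp {X : Hilbert} (f : l2 X) : l2 X := mkl2 _ (inH2_opp f (l2_inH2 f)).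
Definition l2_zero {X : Hilbert} : l2 X := mkl2 _ inH2_zero.
Definition l2_inner {X : Hilbert} (f g : l2 X) : Cx :=
  mkC (Series (fun m => rin (f m) (g m))) (Series (fun m => iin (f m) (g m))).

Lemma l2_inner_addl {X : Hilbert} (f g h : l2 X) :
  l2_inner (l2_add f g) h = Cadd (l2_inner f h) (l2_inner g h).
Proof.
  apply Cx_ext; simpl.
  - rewrite <- Series_plus by (apply ex_series_rin; apply l2_inH2).
    apply Series_ext; intros; apply rin_addl.
  - rewrite <- Series_plus by (apply ex_series_iin; apply l2_inH2).
    apply Series_ext; intros; apply iin_addl.
Qed.

Lemma l2_inner_scall {X : Hilbert} c (f h : l2 X) :
  l2_inner (l2_scal c f) h = Cmul c (l2_inner f h).
Proof.
  pose proof (ex_series_rin f h (l2_inH2 f) (l2_inH2 h)).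
  pose proof (ex_series_iin f h (l2_inH2 f) (l2_inH2 h)).
  apply Cx_ext; simpl; rewrite <- !Series_scal_l.
  - rewrite <- Series_minus by (apply ex_series_mul; assumption).
    apply Series_ext; intros; apply rin_scall.
  - rewrite <- Series_plus by (apply ex_series_mul; assumption).
    apply Series_ext; intros; apply iin_scall.
Qed.

Lemma l2_inner_conj {X : Hilbert} (f h : l2 X) : l2_inner h f = Cconj (l2_inner f h).
Proof.
  apply Cx_ext; simpl.
  - apply Series_ext; intros; apply rin_sym.
  - rewrite <- Series_opp; apply Series_ext; intros; apply iin_sym.
Qed.

Lemma Series_ge0 (a : nat -> R) : (forall k, 0 <= a k) -> ex_series a -> 0 <= Series a.
Proof.
  intros H0 H; eapply Rle_trans; [| apply (sum_le_Series a 0 H0 H)]; apply H0.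
Qed.

Lemma term_le_Series (a : nat -> R) m : (forall k, 0 <= a k) -> ex_series a -> a m <= Series a.
Proof.
  intros H0 H; eapply Rle_trans; [| apply (sum_le_Series a m H0 H)].
  destruct m; simpl; [apply Rle_refl |].
  pose proof (cond_pos_sum a m H0); lra.
Qed.

Lemma l2_inner_pos {X : Hilbert} (f : l2 X) : 0 <= Re (l2_inner f f).
Proof.
  apply Series_ge0; [intros; apply nrm2_ge0 |].
  apply inH2_ex_series, l2_inH2.
Qed.

Lemma l2_inner_def {X : Hilbert} (f : l2 X) : l2_inner f f = C0 -> f = l2_zero.
Proof.
  intros H; apply l2_ext; intros m; simpl; apply nrm2_eq0, Rle_antisym; [| apply nrm2_ge0].
  replace 0 with (Re (l2_inner f f)) by (rewrite H; reflexivity).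
  apply (term_le_Series (fun m => nrm2 (f m))); [intros; apply nrm2_ge0 |].
  apply inH2_ex_series, l2_inH2.
Qed.

Lemma sum_lim (a : nat -> nat -> R) (l : nat -> R) K :
  (forall i, is_lim_seq (fun k => a k i) (l i)) ->
  is_lim_seq (fun k => sum_f_R0 (a k) K) (sum_f_R0 l K).
Proof.
  intros H; induction K as [| K IH]; simpl; [apply H |].
  apply is_lim_seq_plus'; [exact IH | apply H].
Qed.

Lemma l2_complete {X : Hilbert} (u : nat -> l2 X) :
  (forall eps, 0 < eps -> exists N, forall m k, (N <= m)%nat -> (N <= k)%nat ->
      sqrt (Re (l2_inner (l2_add (u m) (l2_opp (u k))) (l2_add (u m) (l2_opp (u k))))) < eps) ->
  exists l, forall eps, 0 < eps -> exists N, forall m, (N <= m)%nat ->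
      sqrt (Re (l2_inner (l2_add (u m) (l2_opp l)) (l2_add (u m) (l2_opp l)))) < eps.
Proof.
  intros Hu.
  assert (Hsq : forall eps, 0 < eps -> exists N, forall m k, (N <= m)%nat -> (N <= k)%nat ->
      Re (l2_inner (l2_add (u m) (l2_opp (u k))) (l2_add (u m) (l2_opp (u k)))) < eps).
  { intros eps He; destruct (Hu (sqrt eps)) as [N HN]; [apply sqrt_lt_R0, He |].
    exists N; intros m k Hm Hk; apply sqrt_lt_0_alt, HN; assumption. }
  assert (Hsum : forall v w : l2 X, ex_series (fun i => nrm2 (hsub (v i) (w i)))).
  { intros v w; apply inH2_ex_series.
    apply (inH2_add v (fun m => hopp (w m))); [| apply inH2_opp]; apply l2_inH2. }
  assert (Hpt : forall i, exists x, conv (fun k => u k i) x).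
  { intros i; apply hilbert_complete; intros eps He.
    destruct (Hsq eps He) as [N HN]; exists N; intros m k Hm Hk.
    eapply Rle_lt_trans; [| apply (HN m k Hm Hk)].
    apply (term_le_Series (fun i => nrm2 (hsub (u m i) (u k i)))); [intros; apply nrm2_ge0 |].
    apply Hsum. }
  apply functional_choice in Hpt as [l Hl].
  (* Fatou argument: the Cauchy bound holds for each partial sum, and in a finite sum [k] may tend
     to infinity coordinatewise. *)
  assert (Hb : forall eps, 0 < eps -> exists N, forall m, (N <= m)%nat ->
     forall K, sum_f_R0 (fun i => nrm2 (hsub (u m i) (l i))) K <= eps).
  { intros eps He; destruct (Hsq eps He) as [N HN]; exists N; intros m Hm K.
    apply (is_lim_seq_le_loc (fun k => sum_f_R0 (fun i => nrm2 (hsub (u m i) (u k i))) K)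
             (fun _ => eps) (sum_f_R0 (fun i => nrm2 (hsub (u m i) (l i))) K) eps).
    - exists N; intros k Hk; apply Rlt_le; eapply Rle_lt_trans; [| apply (HN m k Hm Hk)].
      apply (sum_le_Series (fun i => nrm2 (hsub (u m i) (u k i)))); [intros; apply nrm2_ge0 |].
      apply Hsum.
    - apply (sum_lim (fun k i => nrm2 (hsub (u m i) (u k i)))); intros i.
      apply conv_nrm2, conv_sub_l, Hl.
    - apply is_lim_seq_const. }
  (* The limit is the difference of [u N] and [u N - l], both square-summable. *)
  assert (HlH : inH2 l).
  { destruct (Hb 1 Rlt_0_1) as [N HN]; specialize (HN N (le_n N)).
    apply (series_of_bounded_sums _ _ (fun i => nrm2_ge0 _)) in HN as [HN _].
    apply (inH2_ex_series (fun i => hsub (u N i) (l i))) in HN.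
    pose proof (inH2_add _ _ (l2_inH2 (u N)) (inH2_opp _ HN)) as H.
    revert H; apply (inH2_le 1); intros i.
    replace (hadd (u N i) (hopp (hsub (u N i) (l i)))) with (l i) by vec; lra. }
  exists (mkl2 l HlH); intros eps He.
  destruct (Hb (Rsqr (eps / 2))) as [N HN]; [apply Rlt_0_sqr; lra |].
  exists N; intros m Hm.
  apply Rle_lt_trans with (sqrt (Rsqr (eps / 2))); [| rewrite sqrt_Rsqr; lra].
  apply sqrt_le_1_alt.
  apply (series_of_bounded_sums _ _ (fun i => nrm2_ge0 _) (HN m Hm)).
Qed.

Ltac l2_vec := intros; apply l2_ext; intros; simpl; vec.

Definition l2H (X : Hilbert) : Hilbert.
Proof.
  refine (@Build_Hilbert (l2 X) l2_zero l2_add l2_opp l2_scal l2_inner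
    _ _ _ _ _ _ _ _ l2_inner_addl l2_inner_scall l2_inner_conj l2_inner_pos l2_inner_def
    l2_complete); l2_vec.
Defined.

Definition toH {X : Hilbert} (f : nat -> X) (Hf : inH2 f) : l2H X := mkl2 f Hf.

Definition l2_shift {X : Hilbert} (f : nat -> X) (Hf : inH2 f) (j : nat) : l2H X :=
  mkl2 _ (inH2_shift f j Hf).

Lemma l2_vsum {X : Hilbert} (u : nat -> l2H X) N m :
  l2_fun (vsum u N) m = vsum (fun j => l2_fun (u j) m) N.
Proof. induction N as [| N IH]; simpl; [reflexivity | rewrite IH; reflexivity]. Qed.

(** [in_E] bounds all partial sums of squared norms by [eps], whereas [in_cspan] asks for a norm
    strictly below [eps]. Hence the tolerances [Rsqr (eps / 2)] in one direction and [sqrt eps] in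
    the other. *)
Lemma in_E_cspan {X : Hilbert} (g h : nat -> X) (Hg : inH2 g) (Hh : inH2 h) :
  in_E g h <-> in_cspan (l2_shift g Hg) (toH h Hh).
Proof.
  assert (Hpt : forall N c m,
    l2_fun (hsub (toH h Hh) (vsum (fun j => hscal (c j) (l2_shift g Hg j)) N)) m =
    hsub (h m) (vsum (fun j => hscal (c j) (g (m + j)%nat)) N)).
  { intros N c m; simpl; rewrite l2_vsum; reflexivity. }
  split.
  - intros [_ H] eps He.
    destruct (H (Rsqr (eps / 2))) as [N [c Hc]]; [apply Rlt_0_sqr; lra |].
    exists N, c; apply hnorm_lt; [exact He |].
    apply Rle_lt_trans with (Rsqr (eps / 2)); [| apply Rsqr_incrst_1; lra].
    apply (series_of_bounded_sums _ _ (fun i => nrm2_ge0 _)); intros K.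
    eapply Rle_trans; [| apply (Hc K)]; apply Req_le, sum_eq; intros i _.
    rewrite hnorm_sqr, <- Hpt; reflexivity.
  - intros H; split; [exact Hh |]; intros eps He.
    destruct (H (sqrt eps)) as [N [c Hc]]; [apply sqrt_lt_R0, He |].
    exists N, c; intros K.
    apply hnorm_lt in Hc; [| apply sqrt_lt_R0, He]; rewrite Rsqr_sqrt in Hc by lra.
    apply Rlt_le; eapply Rle_lt_trans; [| exact Hc].
    eapply Rle_trans; [| apply (sum_le_Series _ K (fun i => nrm2_ge0 _))].
    + apply Req_le, sum_eq; intros i _; rewrite hnorm_sqr, <- Hpt; reflexivity.
    + apply inH2_ex_series, l2_inH2.
Qed.

(** Convertible with [orth] in [l2H X] on bundled sequences, but stated without summability
    proofs. *)
Definition orthH2 {X : Hilbert} (f g : nat -> X) : Prop :=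
  Series (fun m => rin (f m) (g m)) = 0 /\ Series (fun m => iin (f m) (g m)) = 0.

Lemma in_E_orth {X : Hilbert} (g h : nat -> X) : inH2 g -> inH2 h ->
  in_E g h <-> forall y, inH2 y -> (forall j, orthH2 (fun m => g (m + j)%nat) y) -> orthH2 h y.
Proof.
  intros Hg Hh; rewrite (in_E_cspan g h Hg Hh), in_cspan_orth; split.
  - intros H y Hy Ho; exact (H (toH y Hy) Ho).
  - intros H y Ho; exact (H y (l2_inH2 y) Ho).
Qed.

(** * Complete relative compactness and lacunary sets *)

Lemma proj_orth {X : Hilbert} (M : X -> Prop) P x m :
  is_orth_proj_onto M P -> M m -> orth (hsub x (P x)) m.
Proof. intros HP Hm; apply inner_eq0, HP, Hm. Qed.

(** Both sides equal the inner product of [P x] and [P y]. *)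
Lemma proj_selfadj {X : Hilbert} (M : X -> Prop) P x y :
  is_orth_proj_onto M P -> rin (P x) y = rin x (P y) /\ iin (P x) y = iin x (P y).
Proof.
  intros HP.
  pose proof (proj_orth M P x (P y) HP (proj1 (HP y))) as [A1 A2].
  pose proof (orth_sym _ _ (proj_orth M P y (P x) HP (proj1 (HP x)))) as [B1 B2].
  revert A1 A2 B1 B2; expand_inner; lra.
Qed.

Lemma proj_fix {X : Hilbert} (M : X -> Prop) P x : is_orth_proj_onto M P -> M x -> P x = x.
Proof.
  intros HP Hx; symmetry; apply hsub_eq0, nrm2_eq0.
  unfold nrm2; rewrite rin_subr.
  rewrite (proj1 (proj_orth M P x x HP Hx)).
  rewrite (proj1 (proj_orth M P x (P x) HP (proj1 (HP x)))); ring.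
Qed.

Lemma proj_compl0 {X : Hilbert} (M : X -> Prop) P x :
  is_orth_proj_onto M P -> P (hsub x (P x)) = hzero.
Proof.
  intros HP; apply nrm2_eq0; unfold nrm2.
  rewrite (proj1 (proj_selfadj M P _ _ HP)), (proj_fix M P (P _) HP) by apply HP.
  apply (proj_orth M P); [exact HP | apply HP].
Qed.

Lemma proj_nrm2 {X : Hilbert} (M : X -> Prop) P x :
  is_orth_proj_onto M P -> nrm2 x = nrm2 (P x) + nrm2 (hsub x (P x)).
Proof.
  intros HP; pose proof (proj_orth M P x (P x) HP (proj1 (HP x))) as [A1 A2].
  revert A1; expand_inner; rewrite (rin_sym (P x) x); lra.
Qed.

Lemma proj_nrm2_le {X : Hilbert} (M : X -> Prop) P x :
  is_orth_proj_onto M P -> nrm2 (P x) <= nrm2 x.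
Proof.
  intros HP; rewrite (proj_nrm2 M P x HP); pose proof (nrm2_ge0 (hsub x (P x))); lra.
Qed.

Lemma proj_compl_nrm2_le {X : Hilbert} (M : X -> Prop) P x :
  is_orth_proj_onto M P -> nrm2 (hsub x (P x)) <= nrm2 x.
Proof.
  intros HP; rewrite (proj_nrm2 M P x HP); pose proof (nrm2_ge0 (P x)); lra.
Qed.

Lemma orth_proj_of_onto {X : Hilbert} (M : X -> Prop) P :
  is_orth_proj_onto M P -> is_orth_proj P.
Proof.
  intros HP; split.
  - intros x; apply (proj_fix M); [exact HP | apply HP].
  - intros x y; apply Cx_ext; apply (proj_selfadj M P x y HP).
Qed.

(** Complete relative compactness is applied to this complementary projection in order to control
    the polynomial part. *)
Lemma orth_proj_compl {X : Hilbert} (M : X -> Prop) P :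
  is_orth_proj_onto M P -> is_orth_proj (fun x => hsub x (P x)).
Proof.
  intros HP; split.
  - intros x; rewrite (proj_compl0 M P x HP); apply hsub_0r.
  - intros x y; destruct (proj_selfadj M P x y HP) as [H1 H2].
    apply Cx_ext; [change (rin (hsub x (P x)) y = rin x (hsub y (P y)))
                  | change (iin (hsub x (P x)) y = iin x (hsub y (P y)))]; expand_inner; lra.
Qed.

Lemma proj_0 {X : Hilbert} (M : X -> Prop) P : is_orth_proj_onto M P -> P hzero = hzero.
Proof.
  intros HP; apply nrm2_eq0, Rle_antisym; [| apply nrm2_ge0].
  rewrite <- (@nrm2_0 X); apply (proj_nrm2_le M P _ HP).
Qed.

Lemma cspan_proj_onto {X : Hilbert} (b : nat -> X) :
  exists P, is_orth_proj_onto (in_cspan b) P.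
Proof.
  destruct (functional_choice _ (cspan_projection b)) as [P HP]; exists P; intros x; split; [apply HP |].
  intros m Hm; apply inner_eq0, orth_sym.
  apply (proj1 (in_cspan_orth b m) Hm); intros k; apply orth_sym, HP.
Qed.

Definition normalize {X : Hilbert} (x : X) : X := hscal (RtoC (/ hnorm x)) x.

Lemma nrm2_pos {X : Hilbert} (x : X) : x <> hzero -> 0 < nrm2 x.
Proof.
  intros Hx; destruct (nrm2_ge0 x) as [H | H]; [exact H |].
  destruct Hx; apply nrm2_eq0; auto.
Qed.

Lemma hnorm_pos {X : Hilbert} (x : X) : x <> hzero -> 0 < hnorm x.
Proof. intros Hx; apply sqrt_lt_R0, nrm2_pos, Hx. Qed.

Lemma nrm2_normalize {X : Hilbert} (x : X) : x <> hzero -> nrm2 (normalize x) = 1.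
Proof.
  intros Hx; pose proof (hnorm_pos x Hx).
  unfold normalize; rewrite nrm2_scal, <- hnorm_sqr; simpl; unfold Rsqr; field; lra.
Qed.

(** The common source of the compactness contradictions: norm one survives in the limit, so any
    argument forcing [v] to be orthogonal to itself is absurd. *)
Lemma crc_limit {X : Hilbert} (a : nat -> X) P (x : nat -> X) :
  crc a -> is_orth_proj P -> (forall j, x j <> hzero /\ exists k, x j = P (a k)) ->
  exists phi v, (forall j, (j <= phi j)%nat) /\
    conv (fun j => normalize (x (phi j))) v /\ nrm2 v = 1.
Proof.
  intros Hc HP Hx.
  destruct (Hc P HP (fun j => normalize (x j))) as [phi [Hphi [v Hv]]].
  { intros j; destruct (Hx j) as [H0 [k Hk]]; exists k; rewrite <- Hk; split; auto. }
  apply conv_iff in Hv; exists phi, v; split; [| split; [exact Hv |]].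
  - intros j; induction j as [| j IH]; [lia | specialize (Hphi j); lia].
  - pose proof (is_lim_seq_unique _ _ (conv_nrm2 _ _ Hv)) as E.
    rewrite (Lim_seq_ext _ (fun _ => 1)), Lim_seq_const in E.
    + congruence.
    + intros j; apply nrm2_normalize, Hx.
Qed.

Lemma conv_orth_from {X : Hilbert} (s : nat -> X) x y N :
  conv s x -> (forall j, (N <= j)%nat -> orth (s j) y) -> orth x y.
Proof.
  intros Hc H; apply (conv_orth (fun j => s (j + N)%nat)).
  - apply (is_lim_seq_incr_n (fun j => nrm2 (hsub (s j) x)) N), Hc.
  - intros j; apply H; lia.
Qed.

Lemma orth_oppl {X : Hilbert} (x y : X) : orth x y -> orth (hopp x) y.
Proof. intros [H1 H2]; split; expand_inner; lra. Qed.

Lemma orth_subl {X : Hilbert} (x y z : X) : orth x z -> orth y z -> orth (hsub x y) z.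
Proof. intros Hx Hy; apply orth_addl; [| apply orth_oppl]; assumption. Qed.

Lemma orth_self {X : Hilbert} (x : X) : orth x x -> x = hzero.
Proof. intros [H _]; apply nrm2_eq0, H. Qed.

Lemma eventually_in_Xstar {X : Hilbert} (a : nat -> X) (f : nat -> X) P :
  crc a -> (forall m, f m <> hzero -> exists k, f m = a k) ->
  is_orth_proj_onto (Xstar f) P ->
  exists N, forall m, (N <= m)%nat -> hsub (f m) (P (f m)) = hzero.
Proof.
  intros Hcrc Hf HP; apply NNPP; intros Hn.
  assert (Hm : forall j, exists m, (j <= m)%nat /\ hsub (f m) (P (f m)) <> hzero).
  { intros j; apply NNPP; intros Hj; apply Hn; exists j; intros m Hm.
    apply NNPP; intros H; apply Hj; exists m; auto. }
  apply functional_choice in Hm as [mu Hmu].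
  set (x := fun j => hsub (f (mu j)) (P (f (mu j)))).
  destruct (crc_limit a (fun x => hsub x (P x)) x Hcrc (orth_proj_compl _ P HP))
    as [phi [v [Hphi [Hv Hv1]]]].
  { intros j; destruct (Hmu j) as [_ H]; split; [exact H |].
    destruct (Hf (mu j)) as [k Hk].
    - intros E; apply H; rewrite E, (proj_0 _ P HP); apply hsub_0r.
    - exists k; unfold x; rewrite Hk; reflexivity. }
  (* For late [j] the coefficient belongs to the tail span from [N], because its index is at least
     [j]; its projection belongs to every tail span. Differences and limits stay there. *)
  assert (HvX : Xstar f v).
  { intros N; apply in_cspan_orth; intros y Hy.
    apply (conv_orth_from _ _ _ N Hv); intros j Hj.
    apply orth_scall, orth_subl.
    - destruct (Hmu (phi j)) as [H _]; specialize (Hphi j).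
      specialize (Hy (mu (phi j) - N)%nat).
      replace (N + (mu (phi j) - N))%nat with (mu (phi j)) in Hy by lia; exact Hy.
    - exact (proj1 (in_cspan_orth _ _) (proj1 (HP (f (mu (phi j)))) N) y Hy). }
  (* Each normalized vector is orthogonal to [Xstar f], in particular to [v]. *)
  assert (Hvv : orth v v).
  { apply (conv_orth _ _ _ Hv); intros j; apply orth_scall, (proj_orth _ _ _ _ HP HvX). }
  rewrite (orth_self _ Hvv), nrm2_0 in Hv1; lra.
Qed.

(** * Lacunary counting and a discrete Gronwall lemma *)

Fixpoint count (p : nat -> bool) (A : nat) : nat :=
  match A with O => O | S A' => ((if p A' then 1 else 0) + count p A')%nat end.

Definition b2R (b : bool) : R := if b then 1 else 0.

Lemma sum_b2R p K : sum_f_R0 (fun m => b2R (p m)) K = INR (count p (S K)).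
Proof.
  induction K as [| K IH].
  - simpl; destruct (p 0%nat); simpl; reflexivity.
  - simpl sum_f_R0; rewrite IH; change (count p (S (S K))) with
      ((if p (S K) then 1 else 0) + count p (S K))%nat.
    rewrite plus_INR; destruct (p (S K)); simpl; lra.
Qed.

(** The exponents are kept as a boolean predicate, with the gap required between any two members,
    because the estimates index coefficients by exponent and not by position in the sequence. *)
Definition lacunary (d : R) (lam : nat -> bool) : Prop :=
  forall x y, lam x = true -> lam y = true -> (x < y)%nat -> d * INR x <= INR y.

(* If [m + s] and [m' + s] with [m < m'] are both in the set then [m' + s >= d (m + s)], so
   the r-th such [m] has [m + s >= d^(r-1) s]; but [d m <= m + s] caps [m + s] at
   [s d / (d - 1)]. *)
Lemma lacunary_pairs d lam : 1 < d -> lacunary d lam ->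
  exists C, forall s A, (0 < s)%nat -> (count (fun m => lam m && lam (m + s)%nat) A <= C)%nat.
Proof.
  intros Hd Hlac.
  (* The added [1] makes the growth strictly exceed the cap [d / (d - 1)] in the final
     comparison. *)
  destruct (Pow_x_infinity d) with (b := d / (d - 1) + 1) as [q Hq].
  { rewrite Rabs_pos_eq; lra. }
  exists (S q); intros s A Hs.
  set (p := fun m => (lam m && lam (m + s)%nat)%bool).
  (* The witness is the largest counted [m] below [A]. The first one counted contributes no factor
     [d], hence the exponent [count p A - 1]. *)
  assert (Hind : count p A <> 0%nat ->
    exists m, (m < A)%nat /\ p m = true /\ d ^ (count p A - 1) * INR s <= INR (m + s)).
  { induction A as [| A IH]; simpl; [congruence |]; intros H.
    destruct (p A) eqn:E; simpl in *.
    - exists A; split; [lia | split; [exact E |]].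
      destruct (count p A) as [| c] eqn:Ec.
      + simpl; rewrite plus_INR; pose proof (pos_INR A); lra.
      + destruct IH as [m [HmA [Hm Hp]]]; [congruence |].
        simpl in Hp |- *; rewrite Nat.sub_0_r in Hp.
        apply andb_prop in E as [_ E]; apply andb_prop in Hm as [_ Hm].
        pose proof (Hlac _ _ Hm E ltac:(lia)) as HL.
        eapply Rle_trans; [| exact HL].
        rewrite Rmult_assoc; apply Rmult_le_compat_l; [lra | exact Hp].
    - destruct (IH H) as [m [HmA Hm]]; exists m; split; [lia | exact Hm]. }
  fold p; destruct (Nat.le_gt_cases (count p A) (S q)) as [| Hgt]; [assumption | exfalso].
  destruct Hind as [m [_ [Hm Hp]]]; [lia |].
  apply andb_prop in Hm as [Hm1 Hm2].
  pose proof (Hlac _ _ Hm1 Hm2 ltac:(lia)) as HL.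
  assert (Hs' : 0 < INR s) by (apply lt_0_INR; exact Hs).
  assert (Hpow : d / (d - 1) + 1 <= d ^ (count p A - 1)).
  { specialize (Hq (count p A - 1)%nat ltac:(lia)).
    rewrite Rabs_pos_eq in Hq by (apply pow_le; lra); lra. }
  assert (Hup : INR (m + s) <= d / (d - 1) * INR s).
  { apply Rmult_le_reg_l with (d - 1); [lra |].
    replace ((d - 1) * (d / (d - 1) * INR s)) with (d * INR s) by (field; lra).
    revert HL; rewrite plus_INR; lra. }
  assert ((d / (d - 1) + 1) * INR s <= d ^ (count p A - 1) * INR s)
    by (apply Rmult_le_compat_r; lra).
  lra.
Qed.

(** Since [1 + e x <= exp (e x)], the product of [t] with the exponential of the partial sums of [e]
    is nondecreasing from [N] on. It is also dominated by [t * exp G], which tends to zero. *)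
Lemma gronwall_vanish (t e : nat -> R) G N :
  (forall x, 0 <= t x) -> (forall x, 0 <= e x) -> (forall K, sum_f_R0 e K <= G) ->
  (forall x, (N <= x)%nat -> t x <= (1 + e x) * t (S x)) -> is_lim_seq t 0 ->
  forall x, (N <= x)%nat -> t x = 0.
Proof.
  intros Ht He HG Hstep Hlim x Hx.
  (* The sum of [e] over indices strictly below [y]; [sum_f_R0] includes its upper index, so zero
     needs its own case. *)
  set (E := fun y => match y with O => 0 | S z => sum_f_R0 e z end).
  assert (HE : forall y, E (S y) = E y + e y) by (intros [| y]; simpl; lra).
  assert (HE0 : forall y, 0 <= E y).
  { intros y; induction y as [| y IH]; [simpl; lra | rewrite HE; specialize (He y); lra]. }
  assert (HEG : forall y, E y <= G).
  { intros [| y]; [| apply HG]; specialize (HG 0%nat); specialize (He 0%nat); simpl in *; lra. }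
  assert (Hmono : forall j, t x * exp (E x) <= t (x + j)%nat * exp (E (x + j)%nat)).
  { intros j; induction j as [| j IH]; [rewrite Nat.add_0_r; lra |].
    eapply Rle_trans; [exact IH |]; rewrite Nat.add_succ_r, HE, exp_plus.
    specialize (Hstep (x + j)%nat ltac:(lia)).
    pose proof (exp_ineq1_le (e (x + j)%nat)).
    pose proof (exp_pos (E (x + j)%nat)).
    pose proof (Ht (S (x + j))).
    assert (t (x + j)%nat <= exp (e (x + j)%nat) * t (S (x + j))).
    { eapply Rle_trans; [exact Hstep |]; apply Rmult_le_compat_r; lra. }
    replace (t (S (x + j)) * (exp (E (x + j)%nat) * exp (e (x + j)%nat)))
      with (exp (e (x + j)%nat) * t (S (x + j)) * exp (E (x + j)%nat)) by ring.
    apply Rmult_le_compat_r; lra. }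
  apply Rle_antisym; [| apply Ht].
  apply (is_lim_seq_le (fun _ => t x) (fun j => t (j + x)%nat * exp G) (t x) 0).
  - intros j; specialize (Hmono j); rewrite (Nat.add_comm j).
    assert (1 <= exp (E x)) by (pose proof (exp_ineq1_le (E x)); specialize (HE0 x); lra).
    assert (exp (E (x + j)%nat) <= exp G).
    { destruct (HEG (x + j)%nat) as [H1 | ->]; [apply Rlt_le, exp_increasing, H1 | lra]. }
    pose proof (Ht x); pose proof (Ht (x + j)%nat); nra.
  - apply is_lim_seq_const.
  - replace (Finite 0) with (Finite (0 * exp G)) by (f_equal; ring).
    apply is_lim_seq_mult'; [| apply is_lim_seq_const].
    apply (is_lim_seq_incr_n t x), Hlim.
Qed.

(** * Tail sums, pair sums and the coefficient estimate *)

Lemma Series_skip (a : nat -> R) l : ex_series a -> (forall m, (m < l)%nat -> a m = 0) ->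
  Series a = a l + Series (fun s => a (s + S l)%nat).
Proof.
  intros Ha H0; rewrite (Series_incr_n a (S l)) by (auto; lia); f_equal; simpl.
  - destruct l as [| l]; [reflexivity |]; simpl.
    rewrite sum_eq_R0; [ring | intros i Hi; apply H0; lia].
  - apply Series_ext; intros s; f_equal; lia.
Qed.

Lemma Series_tail_lim (a : nat -> R) : ex_series a ->
  is_lim_seq (fun x => Series (fun s => a (s + x)%nat)) 0.
Proof.
  intros Ha; apply is_lim_seq_incr_1.
  apply is_lim_seq_ext with (fun K => Series a - sum_f_R0 a K).
  - intros K; rewrite (Series_incr_n a (S K)) by (auto; lia); simpl pred.
    rewrite (Series_ext (fun k => a (S K + k)%nat) (fun s => a (s + S K)%nat)); [ring |].
    intros s; f_equal; lia.
  - replace (Finite 0) with (Finite (Series a - Series a)) by (f_equal; ring).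
    apply is_lim_seq_minus'; [apply is_lim_seq_const |].
    apply is_series_lim_sum, Series_correct, Ha.
Qed.

Lemma sum_Series (F : nat -> nat -> R) A : (forall x, ex_series (F x)) ->
  ex_series (fun s => sum_f_R0 (fun x => F x s) A) /\
  sum_f_R0 (fun x => Series (F x)) A = Series (fun s => sum_f_R0 (fun x => F x s) A).
Proof.
  intros HF; induction A as [| A [IH1 IH2]]; simpl; [auto |]; split.
  - apply ex_series_add; auto.
  - rewrite IH2, <- Series_plus; auto.
Qed.

Lemma inH2_mask {X : Hilbert} (p : nat -> bool) (f : nat -> X) :
  inH2 f -> inH2 (fun m => if p m then f m else hzero).
Proof.
  apply (inH2_le 1); intros m; destruct (p m); [lra |].
  rewrite nrm2_0; pose proof (nrm2_ge0 (f m)); lra.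
Qed.

(** The tails t of the overview, indexed by exponent. *)
Definition tail2 {X : Hilbert} (B : nat -> X) (x : nat) : R :=
  Series (fun s => nrm2 (B (s + x)%nat)).

Lemma tail2_ge0 {X : Hilbert} (B : nat -> X) x : inH2 B -> 0 <= tail2 B x.
Proof.
  intros HB; apply Series_ge0; [intros; apply nrm2_ge0 |].
  apply inH2_ex_series, inH2_shift, HB.
Qed.

(** The quantity gamma of the overview: [S s] is the positive difference between a later exponent
    and [x], and [s + S l] is [l] plus that difference. It vanishes when [x] is no exponent. *)
Definition pair_mass {X : Hilbert} (lam : nat -> bool) (w : nat -> X) (l x : nat) : R :=
  Series (fun s => b2R (lam x && lam (x + S s)%nat) * nrm2 (w (s + S l)%nat)).

Lemma ex_series_mask {X : Hilbert} (p : nat -> bool) (w : nat -> X) : inH2 w ->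
  ex_series (fun s => b2R (p s) * nrm2 (w s)).
Proof.
  intros H; apply (inH2_mask p), inH2_ex_series in H; revert H; apply ex_series_ext.
  intros s; destruct (p s); simpl; [ring | rewrite nrm2_0; ring].
Qed.

Lemma pair_mass_ge0 {X : Hilbert} lam (w : nat -> X) l x : inH2 w -> 0 <= pair_mass lam w l x.
Proof.
  intros Hw; apply Series_ge0.
  - intros s; apply Rmult_le_pos; [| apply nrm2_ge0].
    destruct (lam x && lam (x + S s)%nat)%bool; simpl; lra.
  - apply (ex_series_mask (fun s => lam x && lam (x + S s)%nat)%bool
      (fun s => w (s + S l)%nat)), inH2_shift, Hw.
Qed.

(** After exchanging the sums, [nrm2 (w (s + S l))] is weighted by the number of [x] such that [x]
    and [x + S s] are both exponents, which [lacunary_pairs] bounds uniformly in [s]. *)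
Lemma pair_mass_summable {X : Hilbert} d lam (w : nat -> X) l :
  1 < d -> lacunary d lam -> inH2 w ->
  exists G, forall K, sum_f_R0 (pair_mass lam w l) K <= G.
Proof.
  intros Hd Hlac Hw; destruct (lacunary_pairs d lam Hd Hlac) as [C HC].
  assert (Hw' : inH2 (fun s => w (s + S l)%nat)) by apply inH2_shift, Hw.
  exists (Series (fun s => INR C * nrm2 (w (s + S l)%nat))); intros K.
  destruct (sum_Series (fun x s => b2R (lam x && lam (x + S s)%nat) * nrm2 (w (s + S l)%nat)) K)
    as [_ E].
  { intros x; apply (ex_series_mask (fun s => lam x && lam (x + S s)%nat)%bool
      (fun s => w (s + S l)%nat)), Hw'. }
  unfold pair_mass; rewrite E; apply Series_le.
  - intros s; split.
    + apply cond_pos_sum; intros x; apply Rmult_le_pos; [| apply nrm2_ge0].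
      destruct (lam x && lam (x + S s)%nat)%bool; simpl; lra.
    + rewrite <- (scal_sum (fun x => b2R (lam x && lam (x + S s)%nat))), Rmult_comm.
      apply Rmult_le_compat_r; [apply nrm2_ge0 |].
      rewrite (sum_b2R (fun x => lam x && lam (x + S s)%nat)%bool).
      apply le_INR, HC; lia.
  - apply ex_series_mul; apply inH2_ex_series, Hw'.
Qed.

(* Orthogonality to the shift by [x - l] expresses [<B x, w l>] through the later
   coefficients, the earlier ones being killed by the gap below [x]. *)
Lemma lacunary_coef_le {X : Hilbert} d lam (B w : nat -> X) l x :
  1 < d -> lacunary d lam -> (forall m, lam m = false -> B m = hzero) ->
  inH2 B -> inH2 w -> (l <= x)%nat -> d * INR l < (d - 1) * INR x ->
  orthH2 (fun m => B (m + (x - l))%nat) w ->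
  Rsqr (rin (B x) (w l)) + Rsqr (iin (B x) (w l)) <=
    2 * (tail2 B (S x) * pair_mass lam w l x).
Proof.
  intros Hd Hlac HB HB2 Hw2 Hl Hgap [Ho1 Ho2].
  destruct (lam x) eqn:Hx.
  2: { rewrite (HB x Hx), rin_0l, iin_0l, Rsqr_0.
       pose proof (pair_mass_ge0 lam w l x Hw2).
       pose proof (tail2_ge0 B (S x) HB2).
       nra. }
  (* An exponent below [x] but at least [x - l] would force [d * (x - l) <= x], against the gap
     assumption. *)
  assert (Hzero : forall m, (m < l)%nat -> B (m + (x - l))%nat = hzero).
  { intros m Hm; apply HB; destruct (lam (m + (x - l))%nat) eqn:E; [exfalso | reflexivity].
    pose proof (Hlac _ _ E Hx ltac:(lia)) as H.
    rewrite plus_INR, minus_INR in H by lia; pose proof (pos_INR m); nra. }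
  (* Cauchy-Schwarz will be applied in [l2H X]. Masking [w] does not change the pairing, since
     [B (s + S x)] vanishes off the mask, and it makes the squared norm of [w'] equal to
     [pair_mass]. *)
  set (B' := toH _ (inH2_shift B (S x) HB2)).
  set (w' := toH _ (inH2_mask (fun s => lam x && lam (x + S s)%nat)%bool _
                      (inH2_shift w (S l) Hw2))).
  assert (HBw' : nrm2 B' * nrm2 w' = tail2 B (S x) * pair_mass lam w l x).
  { f_equal; apply Series_ext; intros s; simpl.
    destruct (lam x && lam (x + S s)%nat)%bool; simpl; [unfold nrm2; ring | rewrite rin_0l; ring]. }
  assert (Hmask : forall s, lam x && lam (x + S s)%nat = false -> B (s + S x)%nat = hzero).
  { intros s H; apply HB; rewrite Hx in H; simpl in H.
    rewrite <- H; f_equal; lia. }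
  assert (E1 : rin (B x) (w l) = - rin B' w').
  { rewrite (Series_skip _ l) in Ho1.
    - replace (l + (x - l))%nat with x in Ho1 by lia.
      enough (E : Series (fun s => rin (B (s + S l + (x - l))%nat) (w (s + S l)%nat)) = rin B' w')
        by lra.
      apply Series_ext; intros s; simpl.
      replace (s + S l + (x - l))%nat with (s + S x)%nat by lia.
      destruct (lam x && lam (x + S s)%nat)%bool eqn:E; [reflexivity |].
      rewrite (Hmask s E), !rin_0l; reflexivity.
    - apply ex_series_rin; [apply inH2_shift |]; assumption.
    - intros m Hm; rewrite Hzero by exact Hm; apply rin_0l. }
  assert (E2 : iin (B x) (w l) = - iin B' w').
  { rewrite (Series_skip _ l) in Ho2.
    - replace (l + (x - l))%nat with x in Ho2 by lia.
      enough (E : Series (fun s => iin (B (s + S l + (x - l))%nat) (w (s + S l)%nat)) = iin B' w')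
        by lra.
      apply Series_ext; intros s; simpl.
      replace (s + S l + (x - l))%nat with (s + S x)%nat by lia.
      destruct (lam x && lam (x + S s)%nat)%bool eqn:E; [reflexivity |].
      rewrite (Hmask s E), !iin_0l; reflexivity.
    - apply ex_series_iin; [apply inH2_shift |]; assumption.
    - intros m Hm; rewrite Hzero by exact Hm; apply iin_0l. }
  rewrite E1, E2, <- !Rsqr_neg, <- HBw'.
  pose proof (rin_sqr_le B' w'); pose proof (iin_sqr_le B' w'); lra.
Qed.

(** * Cyclicity *)

Definition cmod2 {X : Hilbert} (x y : X) : R := Rsqr (rin x y) + Rsqr (iin x y).

Lemma cmod2_ge0 {X : Hilbert} (x y : X) : 0 <= cmod2 x y.
Proof. apply Rplus_le_le_0_compat; apply Rle_0_sqr. Qed.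

Lemma cmod2_normalize {X : Hilbert} (x y : X) :
  x <> hzero -> cmod2 (normalize x) y = / nrm2 x * cmod2 x y.
Proof.
  intros Hx; pose proof (hnorm_pos x Hx); rewrite <- hnorm_sqr.
  unfold cmod2, normalize, RtoC; expand_inner; unfold Rsqr; field; lra.
Qed.

Lemma in_cspan_gen {X : Hilbert} (b : nat -> X) k : in_cspan b (b k).
Proof. apply in_cspan_orth; auto. Qed.

Lemma term_le_sum (a : nat -> R) r l :
  (forall k, 0 <= a k) -> (l <= r)%nat -> a l <= sum_f_R0 a r.
Proof.
  intros H0 Hl; induction Hl as [| r Hl IH]; simpl.
  - destruct l as [| l]; simpl; [lra | pose proof (cond_pos_sum a l H0); lra].
  - specialize (H0 (S r)); lra.
Qed.

(* Otherwise complete relative compactness yields a unit vector of the closed span of [w]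
   orthogonal to every [w l]. *)
Lemma crc_lower_bound {X : Hilbert} (a f w : nat -> X) Q :
  crc a -> (forall m, f m <> hzero -> exists k, f m = a k) ->
  is_orth_proj_onto (in_cspan w) Q ->
  exists r, forall x, (r <= x)%nat ->
    nrm2 (Q (f x)) <= (INR r + 1) * sum_f_R0 (fun l => cmod2 (Q (f x)) (w l)) r.
Proof.
  intros Hcrc Hf HQ; apply NNPP; intros Hn.
  (* One index [r] serves as threshold, constant and number of tested coefficients, so the negation
     directly yields a sequence. *)
  assert (Hm : forall r, exists x, (r <= x)%nat /\
    (INR r + 1) * sum_f_R0 (fun l => cmod2 (Q (f x)) (w l)) r < nrm2 (Q (f x))).
  { intros r; apply NNPP; intros Hr; apply Hn; exists r; intros x Hx.
    apply Rnot_lt_le; intros H; apply Hr; exists x; auto. }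
  apply functional_choice in Hm as [mu Hmu].
  assert (Hnz : forall r, Q (f (mu r)) <> hzero).
  { intros r E; destruct (Hmu r) as [_ H]; rewrite E, nrm2_0 in H.
    assert (0 <= sum_f_R0 (fun l => cmod2 (hzero : X) (w l)) r)
      by (apply cond_pos_sum; intros; apply cmod2_ge0).
    pose proof (pos_INR r); nra. }
  destruct (crc_limit a Q (fun r => Q (f (mu r))) Hcrc (orth_proj_of_onto _ Q HQ))
    as [phi [v [Hphi [Hv Hv1]]]].
  { intros r; split; [apply Hnz |]; destruct (Hf (mu r)) as [k Hk].
    - intros E; apply (Hnz r); rewrite E; apply (proj_0 _ Q HQ).
    - exists k; rewrite Hk; reflexivity. }
  (* With [r = phi j], the choice of [mu] bounds each squared coefficient of index at most [r] by
     [/ (INR r + 1)] after normalization, and [j <= r]. *)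
  assert (Hsmall : forall l j, (l <= j)%nat ->
    cmod2 (normalize (Q (f (mu (phi j))))) (w l) <= / (INR j + 1)).
  { intros l j Hj; specialize (Hphi j); set (r := phi j) in *.
    rewrite cmod2_normalize by apply Hnz; destruct (Hmu r) as [_ H].
    pose proof (term_le_sum (fun l => cmod2 (Q (f (mu r))) (w l)) r l
      (fun k => cmod2_ge0 _ _) ltac:(lia)) as Hl; simpl in Hl.
    pose proof (nrm2_pos _ (Hnz r)) as Hp; apply le_INR in Hphi; pose proof (pos_INR j).
    pose proof (cmod2_ge0 (Q (f (mu r))) (w l)).
    apply Rmult_le_reg_l with ((INR j + 1) * nrm2 (Q (f (mu r)))); [nra |].
    replace ((INR j + 1) * nrm2 (Q (f (mu r))) *
      (/ nrm2 (Q (f (mu r))) * cmod2 (Q (f (mu r))) (w l)))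
      with ((INR j + 1) * cmod2 (Q (f (mu r))) (w l)) by (field; lra).
    replace ((INR j + 1) * nrm2 (Q (f (mu r))) * / (INR j + 1))
      with (nrm2 (Q (f (mu r)))) by (field; lra).
    nra. }
  assert (Hvw : forall l, orth v (w l)).
  { intros l.
    assert (Hlim : cmod2 v (w l) <= 0).
    { apply (is_lim_seq_le_loc (fun j => cmod2 (normalize (Q (f (mu (phi j))))) (w l))
        (fun j => / (INR j + 1)) (cmod2 v (w l)) 0).
      - exists l; intros j Hj; apply Hsmall, Hj.
      - apply is_lim_seq_plus'; apply is_lim_seq_mult';
          first [apply (conv_rin _ v (w l) Hv) | apply (conv_iin _ v (w l) Hv)].
      - apply lim_inv_succ. }
    pose proof (Rle_0_sqr (rin v (w l))); pose proof (Rle_0_sqr (iin v (w l))).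
    unfold cmod2 in Hlim; split; apply Rsqr_0_uniq; lra. }
  (* The normalized vectors lie in the closed span of [w], to which [v] is orthogonal. *)
  assert (Hvv : orth v v).
  { apply (conv_orth _ _ _ Hv); intros j; apply orth_scall.
    apply (proj1 (in_cspan_orth w _) (proj1 (HQ _))); intros k; apply orth_sym, Hvw. }
  rewrite (orth_self _ Hvv), nrm2_0 in Hv1; lra.
Qed.

Lemma sum_sum_bounded (F : nat -> nat -> R) r :
  (forall l, exists G, forall K, sum_f_R0 (F l) K <= G) ->
  exists G, forall K, sum_f_R0 (fun x => sum_f_R0 (fun l => F l x) r) K <= G.
Proof.
  intros H; induction r as [| r [G1 IH]]; simpl; [apply H |].
  destruct (H (S r)) as [G2 H2]; exists (G1 + G2); intros K.
  rewrite (plus_sum (fun x => sum_f_R0 (fun l => F l x) r) (F (S r))).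
  specialize (IH K); specialize (H2 K); lra.
Qed.

Lemma tail2_S {X : Hilbert} (B : nat -> X) x : inH2 B -> tail2 B x = nrm2 (B x) + tail2 B (S x).
Proof.
  intros HB; unfold tail2; rewrite Series_incr_1.
  - f_equal; apply Series_ext; intros s; do 2 f_equal; lia.
  - apply inH2_ex_series, inH2_shift, HB.
Qed.

(** Summing the coefficient estimates over [l <= r] and inserting the lower bound gives
    [tail2 B x <= (1 + e x) * tail2 B (S x)] with [e] summable, so [gronwall_vanish] applies. *)
Lemma lacunary_tail_zero {X : Hilbert} d lam (B w : nat -> X) N r :
  1 < d -> lacunary d lam -> (forall m, lam m = false -> B m = hzero) -> inH2 B -> inH2 w ->
  (forall j, (N <= j)%nat -> orthH2 (fun m => B (m + j)%nat) w) ->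
  (forall x, (r <= x)%nat ->
    nrm2 (B x) <= (INR r + 1) * sum_f_R0 (fun l => cmod2 (B x) (w l)) r) ->
  exists K, forall x, (K <= x)%nat -> B x = hzero.
Proof.
  intros Hd Hlac HB HB2 Hw2 Ho Hr.
  pose proof (pos_INR r) as Hr0.
  (* Beyond [K0] the gap assumption of the coefficient estimate holds for all [l <= r] at once. *)
  destruct (INR_unbounded (d * INR r / (d - 1))) as [K0 HK0].
  (* The [2] comes from the coefficient estimate, the factor [INR r + 1] from the lower bound. *)
  set (e := fun x => 2 * (INR r + 1) * sum_f_R0 (fun l => pair_mass lam w l x) r).
  destruct (sum_sum_bounded (pair_mass lam w) r) as [G HG].
  { intros l; apply (pair_mass_summable d); assumption. }
  exists (N + r + K0)%nat; intros x Hx; apply nrm2_eq0.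
  enough (Ht : tail2 B x = 0).
  { pose proof (tail2_S B x HB2); pose proof (tail2_ge0 B (S x) HB2).
    pose proof (nrm2_ge0 (B x)); lra. }
  revert x Hx; apply (gronwall_vanish (tail2 B) e (2 * (INR r + 1) * G)).
  - intros x; apply tail2_ge0, HB2.
  - intros x; apply Rmult_le_pos; [lra |].
    apply cond_pos_sum; intros l; apply pair_mass_ge0, Hw2.
  - intros K; unfold e.
    rewrite (sum_eq _ (fun x => sum_f_R0 (fun l => pair_mass lam w l x) r * (2 * (INR r + 1))))
      by (intros; ring).
    rewrite <- scal_sum; apply Rmult_le_compat_l; [lra | apply HG].
  - intros x Hx; rewrite (tail2_S B x HB2).
    assert (HxK : d * INR r < (d - 1) * INR x).
    { assert (INR K0 <= INR x) by (apply le_INR; lia).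
      apply Rmult_lt_reg_r with (/ (d - 1)); [apply Rinv_0_lt_compat; lra |].
      replace ((d - 1) * INR x * / (d - 1)) with (INR x) by (field; lra).
      unfold Rdiv in HK0; lra. }
    assert (Hsum : sum_f_R0 (fun l => cmod2 (B x) (w l)) r <=
       sum_f_R0 (fun l => pair_mass lam w l x) r * (2 * tail2 B (S x))).
    { rewrite Rmult_comm, scal_sum.
      apply sum_Rle; intros l Hl; unfold cmod2.
      eapply Rle_trans; [apply (lacunary_coef_le d lam B w l x Hd Hlac HB HB2 Hw2) |].
      - lia.
      - apply le_INR in Hl; nra.
      - apply Ho; lia.
      - apply Req_le; ring. }
    eapply Rle_trans; [apply Rplus_le_compat_r, Hr; lia |].
    unfold e; nra.
  - apply (Series_tail_lim (fun s => nrm2 (B s))), inH2_ex_series, HB2.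
Qed.

(** The analytic core, in dual form: it yields the inclusion in E_f of the functions with values in
    [Xstar f]. *)
Lemma orth_shifts_orth_Xstar {X : Hilbert} d lam (a f g : nat -> X) P N :
  1 < d -> lacunary d lam -> (forall m, lam m = false -> f m = hzero) ->
  (forall m, f m <> hzero -> exists k, f m = a k) -> crc a ->
  is_orth_proj_onto (Xstar f) P -> (forall m, (N <= m)%nat -> hsub (f m) (P (f m)) = hzero) ->
  inH2 f -> inH2 g -> (forall j, orthH2 (fun m => f (m + j)%nat) g) ->
  forall l, P (g l) = hzero.
Proof.
  intros Hd Hlac Hlam Hf Hcrc HP HN Hf2 Hg2 Ho l.
  set (w := fun m => P (g m)).
  destruct (cspan_proj_onto w) as [Q HQ].
  assert (Hw2 : inH2 w).
  { revert Hg2; apply (inH2_le 1); intros m; rewrite Rmult_1_l; apply (proj_nrm2_le _ P _ HP). }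
  assert (HB2 : inH2 (fun m => Q (f m))).
  { revert Hf2; apply (inH2_le 1); intros m; rewrite Rmult_1_l; apply (proj_nrm2_le _ Q _ HQ). }
  destruct (crc_lower_bound a f w Q Hcrc Hf HQ) as [r Hr].
  (* [Q] fixes [w m], and [P] fixes [f y] once [y >= N]. Moving both projections across transfers
     orthogonality from [f] and [g] to [Q f] and [w], for shifts by at least [N]. *)
  assert (Hin : forall y m, (N <= y)%nat ->
    rin (Q (f y)) (w m) = rin (f y) (g m) /\ iin (Q (f y)) (w m) = iin (f y) (g m)).
  { intros y m Hy.
    destruct (proj_selfadj _ Q (f y) (w m) HQ) as [-> ->].
    rewrite (proj_fix _ Q _ HQ (in_cspan_gen w m)); unfold w.
    destruct (proj_selfadj _ P (f y) (g m) HP) as [<- <-].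
    rewrite <- (hsub_eq0 _ _ (HN y Hy)); auto. }
  destruct (lacunary_tail_zero d lam (fun m => Q (f m)) w N r Hd Hlac) as [K HK]; auto.
  { intros m Hm; rewrite (Hlam m Hm); apply (proj_0 _ Q HQ). }
  { intros j Hj; destruct (Ho j) as [Ho1 Ho2]; split.
    - rewrite <- Ho1; apply Series_ext; intros m; apply Hin; lia.
    - rewrite <- Ho2; apply Series_ext; intros m; apply Hin; lia. }
  (* [P (g l)] lies in the tail span of [f] from [K], and each generator of that span is orthogonal
     to it because [Q] kills the generator and fixes [w l]. *)
  apply orth_self.
  apply (proj1 (in_cspan_orth _ _) (proj1 (HP (g l)) K)); intros k.
  destruct (proj_selfadj _ Q (f (K + k)%nat) (w l) HQ) as [E1 E2].
  rewrite (proj_fix _ Q _ HQ (in_cspan_gen w l)), HK in E1, E2 by lia.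
  rewrite rin_0l in E1; rewrite iin_0l in E2.
  split; symmetry; assumption.
Qed.

(** * Orthogonality in H^2 and the decomposition *)

Lemma orthH2_sym {X : Hilbert} (u v : nat -> X) : orthH2 u v -> orthH2 v u.
Proof.
  intros [H1 H2]; split.
  - rewrite <- H1; apply Series_ext; intros; apply rin_sym.
  - rewrite <- Ropp_0, <- H2, <- Series_opp; apply Series_ext; intros; apply iin_sym.
Qed.

Lemma orthH2_pointwise {X : Hilbert} (u v : nat -> X) :
  (forall m, orth (u m) (v m)) -> orthH2 u v.
Proof.
  intros H; assert (Series (fun _ => 0) = 0).
  { apply is_series_unique, is_series_lim_sum.
    apply is_lim_seq_ext with (fun _ => 0); [| apply is_lim_seq_const].
    intros K; symmetry; apply sum_eq_R0; auto. }
  split; erewrite Series_ext; try eassumption; intros m; apply H.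
Qed.

Lemma orthH2_addl {X : Hilbert} (u v y : nat -> X) : inH2 u -> inH2 v -> inH2 y ->
  orthH2 u y -> orthH2 v y -> orthH2 (fun m => hadd (u m) (v m)) y.
Proof.
  intros Hu Hv Hy [U1 U2] [V1 V2]; split.
  - rewrite (Series_ext _ (fun m => rin (u m) (y m) + rin (v m) (y m))) by (intros; apply rin_addl).
    rewrite Series_plus, U1, V1; [ring | apply ex_series_rin; assumption ..].
  - rewrite (Series_ext _ (fun m => iin (u m) (y m) + iin (v m) (y m))) by (intros; apply iin_addl).
    rewrite Series_plus, U2, V2; [ring | apply ex_series_iin; assumption ..].
Qed.

Lemma orthH2_ext {X : Hilbert} (u v u' v' : nat -> X) :
  (forall m, rin (u m) (v m) = rin (u' m) (v' m) /\ iin (u m) (v m) = iin (u' m) (v' m)) ->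
  orthH2 u v -> orthH2 u' v'.
Proof.
  intros H [H1 H2]; split; [rewrite <- H1 | rewrite <- H2]; apply Series_ext;
    intros m; symmetry; apply H.
Qed.

Lemma orthH2_inner {X : Hilbert} (u v : nat -> X) :
  inH2 u -> inH2 v -> orthH2 u v -> h2_inner_is u v C0.
Proof.
  intros Hu Hv [H1 H2]; split; apply is_series_Reals; simpl.
  - rewrite <- H1; apply Series_correct, ex_series_rin; assumption.
  - rewrite <- H2; apply Series_correct, ex_series_iin; assumption.
Qed.

(** From consecutive exponents to arbitrary pairs: the successor of [x] in the sequence is at most
    [y]. *)
Lemma lacunary_of_seq d (n : nat -> nat) lam :
  (forall k, (n k < n (S k))%nat) -> (forall k, d * INR (n k) <= INR (n (S k))) ->
  (forall m, lam m = true <-> exists k, n k = m) -> lacunary d lam.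
Proof.
  intros Hinc Hlac Hlam x y Hx Hy Hxy.
  apply Hlam in Hx as [k <-]; apply Hlam in Hy as [j <-].
  assert (Hmono : forall i j, (i <= j)%nat -> (n i <= n j)%nat).
  { intros i j' Hij; induction Hij as [| j' _ IH]; [lia | specialize (Hinc j'); lia]. }
  eapply Rle_trans; [apply Hlac |]; apply le_INR, Hmono.
  destruct (Nat.le_gt_cases (S k) j) as [| Hjk]; [assumption |].
  specialize (Hmono j k ltac:(lia)); lia.
Qed.

Theorem theorem1p1 (X : Hilbert) (Hsep : @separable X)
  (a : nat -> X) (n : nat -> nat) (d : R)
  (Hd : 1 < d)
  (Hinc : forall k, (n k < n (S k))%nat)
  (Hlac : forall k, d * INR (n k) <= INR (n (S k)))
  (f : nat -> X)
  (Hf1 : forall k, f (n k) = a k)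
  (Hf0 : forall m, (forall k, n k <> m) -> f m = hzero)
  (HfH2 : inH2 f)
  (Hcrc : crc a)
  (P : X -> X) (HP : is_orth_proj_onto (Xstar f) P) :
  let p := fun m => hsub (f m) (P (f m)) in
  (exists N, forall m, (N <= m)%nat -> p m = hzero) /\
  (forall h, in_E f h <->
     exists u v, inH2_sub (Xstar f) u /\ in_E p v /\ forall m, h m = hadd (u m) (v m)) /\
  (forall u v, inH2_sub (Xstar f) u -> in_E p v -> h2_inner_is u v C0).
Proof.
  intros p.
  assert (Hlam : exists lam : nat -> bool, forall m, lam m = true <-> exists k, n k = m).
  { apply (functional_choice (fun m b => b = true <-> exists k, n k = m)); intros m.
    destruct (classic (exists k, n k = m)); [exists true | exists false];
      split; auto; discriminate. }
  destruct Hlam as [lam Hlam].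
  assert (Hlam0 : forall m, lam m = false -> f m = hzero).
  { intros m Hm; apply Hf0; intros k Hk.
    assert (lam m = true) by (apply Hlam; exists k; exact Hk); congruence. }
  assert (Hfa : forall m, f m <> hzero -> exists k, f m = a k).
  { intros m Hm; destruct (lam m) eqn:E; [| destruct (Hm (Hlam0 m E))].
    apply Hlam in E as [k <-]; exists k; apply Hf1. }
  destruct (eventually_in_Xstar a f P Hcrc Hfa HP) as [N HN].
  assert (Hcompl : forall h, inH2 h -> inH2 (fun m => hsub (h m) (P (h m)))).
  { intros h; apply (inH2_le 1); intros m; rewrite Rmult_1_l; apply (proj_compl_nrm2_le _ P _ HP). }
  assert (HPH2 : forall h, inH2 h -> inH2 (fun m => P (h m))).
  { intros h; apply (inH2_le 1); intros m; rewrite Rmult_1_l; apply (proj_nrm2_le _ P _ HP). }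
  assert (HpH2 : inH2 p) by apply Hcompl, HfH2.
  (* Dual form of one inclusion: whatever is orthogonal to all shifts of [f] takes values orthogonal
     to [Xstar f]. *)
  assert (Hmain : forall y, inH2 y -> (forall j, orthH2 (fun m => f (m + j)%nat) y) ->
    forall x m, Xstar f x -> orth x (y m)).
  { intros y Hy Ho x m Hx; apply orth_sym.
    pose proof (orth_shifts_orth_Xstar d lam a f y P N Hd (lacunary_of_seq d n lam Hinc Hlac Hlam)
      Hlam0 Hfa Hcrc HP HN HfH2 Hy Ho m) as H0.
    rewrite <- (hsub_0r (y m)), <- H0; exact (proj_orth _ P _ _ HP Hx). }
  assert (HQadj : forall x y : X, rin (hsub x (P x)) y = rin x (hsub y (P y)) /\
                                  iin (hsub x (P x)) y = iin x (hsub y (P y))).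
  { intros x y; destruct (proj_selfadj _ P x y HP) as [E1 E2]; expand_inner; lra. }
  split; [exists N; exact HN | split].
  - intros h; split.
    + intros Hh; pose proof (proj1 Hh) as Hh2.
      exists (fun m => P (h m)), (fun m => hsub (h m) (P (h m))); split; [| split].
      * split; [apply HPH2, Hh2 | intros m; apply HP].
      (* Testing [(I - P) h] against [y] amounts to testing [h] against [(I - P) y], which is
         orthogonal to all shifts of [f] because [y] is orthogonal to all shifts of [p]. *)
      * apply in_E_orth; [exact HpH2 | apply Hcompl, Hh2 |]; intros y Hy Ho.
        apply (orthH2_ext h (fun m => hsub (y m) (P (y m)))).
        { intros m; destruct (HQadj (h m) (y m)) as [-> ->]; auto. }
        apply (proj1 (in_E_orth f h HfH2 Hh2) Hh); [apply Hcompl, Hy |]; intros j.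
        apply (orthH2_ext _ _ _ _ (fun m => HQadj (f (m + j)%nat) (y m)) (Ho j)).
      * intros m; vec.
    + intros [u [v [[Hu2 HuX] [Hv Hh]]]]; pose proof (proj1 Hv) as Hv2.
      apply functional_extensionality in Hh; subst h.
      apply in_E_orth; [exact HfH2 | apply inH2_add; assumption |]; intros y Hy Ho.
      apply orthH2_addl; auto.
      * apply orthH2_pointwise; intros m; apply (Hmain y Hy Ho), HuX.
      (* Here [y] is also orthogonal to the shifts of [p]: the removed part [P (f (m + j))] lies in
         [Xstar f] and pairs to zero with [y m]. *)
      * apply (proj1 (in_E_orth p v HpH2 Hv2) Hv y Hy); intros j.
        refine (orthH2_ext _ _ _ _ _ (Ho j)); intros m; unfold p.
        destruct (Hmain y Hy Ho (P (f (m + j)%nat)) m (proj1 (HP _))) as [E1 E2].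
        expand_inner; lra.
  - intros u v [Hu2 HuX] Hv; pose proof (proj1 Hv) as Hv2.
    apply orthH2_inner; [assumption .. |]; apply orthH2_sym.
    (* The duality test for [v] with [u] as test function: all shifts of [p] are orthogonal to [u]
       coefficient by coefficient. *)
    apply (proj1 (in_E_orth p v HpH2 Hv2) Hv u Hu2); intros j.
    apply orthH2_pointwise; intros m; apply (proj_orth _ P _ _ HP (HuX m)).
Qed.
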